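(* Let $\mathbb{X}$ be a finite dimensional real inner product space and let $\mathcal{K}\subseteq\mathbb{X}$ be a nonempty closed convex cone. Then the projection $P_{\mathcal{K}}\colon\mathbb{X}\to\mathbb{X}$ is differentiable almost everywhere. The Jacobian $P_{\mathcal{K}}'(x)$ (whenever it exists) and any Clarke generalized Jacobian $V(x)\in\partial_C P_{\mathcal{K}}(x)$, for all $x\in\mathbb{X}$, are self-adjoint and positive semidefinite operators. Moreover, the following properties hold: (i) $\|V(x)\|\le 1$ for all $x\in\mathbb{X}$ and all $V(x)\in\partial_C P_{\mathcal{K}}(x)$. (ii) $P_{\mathcal{K}}'(x)x=P_{\mathcal{K}}(x)$ for all $x\in D_{P_{\mathcal{K}}}$. (iii) $V(x)x=P_{\mathcal{K}}(x)$ for all $x\in\mathbb{X}$ and all $V(x)\in\partial_C P_{\mathcal{K}}(x)$. (iv) For all $x\in\mathbb{X}$ and all $V(x)\in\partial_C P_{\mathcal{K}}(x)$, $0\le\lambda_{\min}(V(x))\le\lambda_{\max}(V(x))\le 1$.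
   Context: $\langle\cdot,\cdot\rangle$ is the inner product of $\mathbb{X}$, $\|x\|=\sqrt{\langle x,x\rangle}$, and for a linear operator $T\colon\mathbb{X}\to\mathbb{X}$, $\|T\|=\max\{\|Tx\| : \|x\|=1\}$ is the operator norm. $P_{\mathcal{K}}(x)=\operatorname{argmin}\{\|y-x\| : y\in\mathcal{K}\}$ is the projection of $x$ onto $\mathcal{K}$. For a mapping $F\colon\mathbb{X}\to\mathbb{X}$, $D_F$ is the set of points at which $F$ is differentiable, $F'(x)$ is the Jacobian (derivative) at $x\in D_F$, and the set of Clarke generalized Jacobians at $x\in\mathbb{X}$ is $\partial_C F(x)=\operatorname{conv}\{\lim_{k\to\infty}F'(x_k) : x_k\to x,\ x_k\in D_F\}$. A self-adjoint linear operator $T$ is positive semidefinite if $\langle Tx,x\rangle\ge 0$ for all $x$; $\lambda_{\min}(T)$ and $\lambda_{\max}(T)$ denote the smallest and largest eigenvalues of a self-adjoint $T$. *)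

(* Defs.v *)
From HB Require Import structures.
From mathcomp Require Import all_boot all_order all_algebra.
From mathcomp Require Import sesquilinear.
From mathcomp Require Import all_classical all_reals all_analysis.

Set Implicit Arguments.
Unset Strict Implicit.
Unset Printing Implicit Defensive.

Import Order.TTheory GRing.Theory Num.Theory.
Import numFieldNormedType.Exports.

Local Open Scope classical_set_scope.
Local Open Scope ring_scope.

#[short(type="finNormedModType")]
HB.structure Definition FinNormedModule (R : realType) :=
  {X of NormedModule R X & Vector R X}.

(* A finite-dimensional inner product space is a finNormedModType X together
   with a dot product ip that induces the norm (hence the topology) of X. *)
Definition norm_of_dot (R : realType) (X : finNormedModType R)
    (ip : {dot X for (idfun : R -> R)}) : Prop :=
  forall x : X, `|x| = Num.sqrt (ip x x).

(* R^n is encoded as R * (R * (... * unit)), so that its Lebesgue measure is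
   an iterated product measure. *)
Fixpoint euclidean (R : realType) (n : nat) : {d & measurableType d} :=
  if n is m.+1 then
    existT _ _ ((measurableTypeR R * projT2 (euclidean R m))%type
                : measurableType _)
  else existT _ _ (unit : measurableType _).

Definition eucl (R : realType) (n : nat) := projT2 (euclidean R n).

(* The library's instance of sigma-finiteness for m1 \x m2 is hidden by the one
   for subprobability measures, hence this copy of m1 \x m2. *)
Section sigma_finite_product.
Context d1 d2 (T1 : measurableType d1) (T2 : measurableType d2) (R : realType).
Variable m1 : {sigma_finite_measure set T1 -> \bar R}.
Variable m2 : {sigma_finite_measure set T2 -> \bar R}.

Definition sigma_finite_product : set (T1 * T2) -> \bar R := (m1 \x m2)%E.

HB.instance Definition _ := Measure.on sigma_finite_product.

Let sigma_finite_productT : sigma_finite setT sigma_finite_product.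
Proof.
have /sigma_finiteP[F [TF ndF Foo]] := sigma_finiteT m1.
have /sigma_finiteP[G [TG ndG Goo]] := sigma_finiteT m2.
exists (fun n => F n `*` G n).
  rewrite -setXTT TF TG predeqE => -[x y]; split.
    move=> [/= [n _ Fnx] [k _ Gky]]; exists (maxn n k) => //; split.
    - by move: x Fnx; exact/subsetPset/ndF/leq_maxl.
    - by move: y Gky; exact/subsetPset/ndG/leq_maxr.
  by move=> [n _ []/= ? ?]; split; exists n.
move=> k; have [? ?] := Foo k; have [? ?] := Goo k.
split; first exact: measurableX.
rewrite /sigma_finite_product product_measure1E// lte_mul_pinfty//.
by rewrite ge0_fin_numE.
Qed.

HB.instance Definition _ := Measure_isSigmaFinite.Build _ _ _
  sigma_finite_product sigma_finite_productT.

End sigma_finite_product.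

Fixpoint euclidean_lebesgue (R : realType) (n : nat) :
    {sigma_finite_measure set (eucl R n) -> \bar R} :=
  match n return {sigma_finite_measure set (eucl R n) -> \bar R} with
  | 0 => @dirac _ unit tt R
  | m.+1 =>
      sigma_finite_product (@lebesgue_measure R) (euclidean_lebesgue R m)
  end.

Fixpoint eucl_nth (R : realType) (n : nat) : eucl R n -> nat -> R :=
  match n return eucl R n -> nat -> R with
  | 0 => fun _ _ => 0
  | m.+1 => fun t i => if i is j.+1 then eucl_nth t.2 j else t.1
  end.

(* A property holds almost everywhere on X if it does on R^n through the
   coordinates in a basis of X; null sets do not depend on this basis. *)
Definition ae_lebesgue (R : realType) (X : finNormedModType R)
    (Q : X -> Prop) : Prop :=
  forall e : (\dim {:X}).-tuple X, basis_of {:X} e ->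
  {ae euclidean_lebesgue R (\dim {:X}),
    forall t, Q (\sum_(i < \dim {:X}) eucl_nth t i *: e`_i)}.

Definition convex_cone (R : realType) (X : lmodType R) (K : set X) : Prop :=
  convex_set (K : set (convex_lmodType X)) /\
  (forall (t : R) (x : X), 0 < t -> K x -> K (t *: x)).

Definition argmin_on (R : realType) (T : Type) (f : T -> R) (A : set T) :
    set T :=
  [set p | A p /\ forall y, A y -> f p <= f y].

(* The argmin is a singleton when K is nonempty, closed and convex. *)
Definition metric_proj (R : realType) (X : finNormedModType R) (K : set X)
    (x : X) : X :=
  get (argmin_on (fun y => `|y - x|) K).

(* The supremum is a maximum by compactness of the unit sphere; on the zero
   space the sphere is empty and opnorm T = sup set0 = 0. *)
Definition opnorm (R : realType) (X : finNormedModType R) (T : 'End(X)) : R :=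
  sup [set `|T x| | x in [set x : X | `|x| = 1]].

Definition diff_points (R : realType) (X : finNormedModType R) (F : X -> X) :
    set X :=
  [set x | differentiable F x].

Definition fderiv (R : realType) (X : finNormedModType R) (F : X -> X)
    (x : X) : 'End(X) :=
  linfun ('d F x).

Definition conv_hull (R : realType) (V : lmodType R) (A : set V) : set V :=
  [set v | exists (m : nat) (c : 'I_m -> R) (a : 'I_m -> V),
     [/\ forall i, 0 <= c i, \sum_(i < m) c i = 1, forall i, A (a i)
       & v = \sum_(i < m) c i *: a i]].

Definition limiting_jacobians (R : realType) (X : finNormedModType R)
    (F : X -> X) (x : X) : set 'End(X) :=
  [set L | exists u : nat -> X,
     [/\ u k @[k --> \oo] --> x, forall k, diff_points F (u k)
       & opnorm (fderiv F (u k) - L) @[k --> \oo] --> (0 : R)]].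

Definition clarke_jacobian (R : realType) (X : finNormedModType R)
    (F : X -> X) (x : X) : set 'End(X) :=
  conv_hull (limiting_jacobians F x).

Definition self_adjoint (R : realType) (X : finNormedModType R)
    (ip : {dot X for (idfun : R -> R)}) (T : 'End(X)) : Prop :=
  forall x y : X, ip (T x) y = ip x (T y).

Definition psd (R : realType) (X : finNormedModType R)
    (ip : {dot X for (idfun : R -> R)}) (T : 'End(X)) : Prop :=
  self_adjoint ip T /\ forall x : X, 0 <= ip (T x) x.

Definition is_lambda_min (R : realType) (X : finNormedModType R)
    (T : 'End(X)) (a : R) : Prop :=
  passmx.leigenvalue T a /\ forall b, passmx.leigenvalue T b -> a <= b.

Definition is_lambda_max (R : realType) (X : finNormedModType R)
    (T : 'End(X)) (a : R) : Prop :=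
  passmx.leigenvalue T a /\ forall b, passmx.leigenvalue T b -> b <= a.

(* Main.v *)
Require Import Defs.
From HB Require Import structures.
From mathcomp Require Import all_boot all_order all_algebra.
From mathcomp Require Import sesquilinear.
From mathcomp Require Import all_classical all_reals all_analysis.
From mathcomp Require Import measurable_realfun.
From mathcomp Require Import ring lra.
Import Order.TTheory GRing.Theory Num.Theory.
Import numFieldNormedType.Exports.
Set Implicit Arguments.
Unset Strict Implicit.
Unset Printing Implicit Defensive.
Local Open Scope classical_set_scope.
Local Open Scope ring_scope.

(** The projection P onto K is characterized by <x - P x, y> <= 0 on K and
    <x - P x, P x> = 0; hence P is firmly nonexpansive, positively homogeneous
    and the gradient of the convex function |P x|^2 / 2.  At a point of
    differentiability, P' is therefore symmetric (second differences of the
    potential), positive semidefinite, of norm at most 1, and P'(x) x = P x.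
    All these properties survive limits and convex combinations, and the
    extreme eigenvalues are extrema of the Rayleigh quotient.

    Almost everywhere differentiability is Rademacher's theorem, by induction
    on the dimension.  In dimension 1 a Lipschitz function is, up to an affine
    term, the distribution function of a measure dominated by the Lebesgue
    measure, hence an indefinite integral.  For f(x, y) with x real, the
    derivative in y exists almost everywhere by induction, with a uniform
    modulus on each set of a countable family; f is differentiable at (x, y)
    as soon as x is a density point of the horizontal section of such a set
    and f(., y) is derivable at x, because f can then be expanded along y from
    a point of the set close to (x + h, y). *)

(** * Lipschitz functions of one real variable *)

Lemma lebesgue_stieltjes_measure_itv (R : realType) (F : cumulative R R) (a b : R) :
  a <= b -> lebesgue_stieltjes_measure F `]a, b] = (F b - F a)%:E.
Proof.
move=> ab; rewrite /lebesgue_stieltjes_measure /measure_extension.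
by rewrite measurable_mu_extE/= ?wlength_itv_bnd//; exact: is_ocitv.
Qed.

(** Both sides are measures that agree on half-open intervals, so uniqueness of the Lebesgue measure
    applies. This is what bounds each Stieltjes measure by the Lebesgue measure. *)
Lemma lebesgue_stieltjes_add_id (R : realType) (F G : cumulative R R) :
  (forall x, F x + G x = x) ->
  forall A, measurable A ->
  (lebesgue_measure A = lebesgue_stieltjes_measure F A
                        + lebesgue_stieltjes_measure G A)%E.
Proof.
move=> FG A mA.
rewrite -[RHS](measure_addE (lebesgue_stieltjes_measure F)
  (lebesgue_stieltjes_measure G)).
apply: lebesgue_measure_unique => // _ [[a b] _ <-].
apply: etrans (esym (measure_addE _ _ _)).
have [ab|ba] := leP a b; last first.
  by rewrite set_itv_ge ?bnd_simp -?leNgt ?(ltW ba)// !measure0 adde0.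
rewrite /lebesgue_measure (lebesgue_stieltjes_measure_itv _ ab)/=.
rewrite (lebesgue_stieltjes_measure_itv F ab) (lebesgue_stieltjes_measure_itv G ab).
rewrite -EFinD.
by congr (_%:E); have := FG a; have := FG b; lra.
Qed.

Lemma derivable_add_affine (R : realType) (G : R -> R) (c k x : R) :
  derivable G x 1 -> derivable (fun y => G y + c - y * k) x 1.
Proof.
move=> dG; have d1 := derivableD dG (@derivable_cst R R R c x 1).
have d2 := derivableM (@derivable_id R R x 1) (@derivable_cst R R R k x 1).
exact: (derivableB d1 d2).
Qed.

(* With constant 1/2, both x/2 + f and x/2 - f are nondecreasing, and their
   Stieltjes measures add up to the Lebesgue measure. *)
Lemma half_lipschitz_derivable_ae (R : realType) (f : R -> R) :
  (forall x y, `|f x - f y| <= `|x - y| / 2) ->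
  {ae lebesgue_measure, forall x, derivable f x 1}.
Proof.
move=> lf.
have lf' x y : x <= y -> `|f y - f x| <= (y - x) / 2.
  by move=> xy; rewrite (le_trans (lf _ _))// ger0_norm// subr_ge0.
pose F0 x := x / 2 + f x; pose G0 x := x / 2 - f x.
have ndF : nondecreasing F0.
  by move=> x y xy; have := lf' _ _ xy; rewrite ler_norml /F0 => /andP[]; lra.
have ndG : nondecreasing G0.
  by move=> x y xy; have := lf' _ _ xy; rewrite ler_norml /G0 => /andP[]; lra.
have cf : continuous f.
  move=> x; apply/cvgrPdist_le => e e0; near=> y.
  apply: (le_trans (lf _ _)); rewrite ler_pdivrMr//.
  have : `|x - y| <= e by near: y; apply: cvgr_dist_le.
  by move=> ?; lra.
have cF : continuous F0.
  by move=> x; apply: cvgD; [apply: cvgMl; exact: cvg_id|exact: cf].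
have cG : continuous G0.
  by move=> x; apply: cvgB; [apply: cvgMl; exact: cvg_id|exact: cf].
pose F : cumulative R R :=
  HB.pack F0 (isCumulative.Build R _ R F0 ndF (right_continuousW cF)).
pose G : cumulative R R :=
  HB.pack G0 (isCumulative.Build R _ R G0 ndG (right_continuousW cG)).
have FG x : F x + G x = x by rewrite /= /F0 /G0; lra.
pose mu := @lebesgue_measure R.
pose nu := lebesgue_stieltjes_measure F.
have nu_le A : measurable A -> (nu A <= mu A)%E.
  move=> mA; rewrite /mu (lebesgue_stieltjes_add_id FG mA) leeDl//.
have nu_itv (a b : R) : a <= b -> nu `]a, b]%classic = (F0 b - F0 a)%:E.
  exact: lebesgue_stieltjes_measure_itv.
(* The Stieltjes measure of a bounded interval is finite, which the restriction [mfrestr] asks for;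
   countably many such intervals cover the line. *)
suff H (n : nat) : {ae mu, forall x, x \in `]-(n%:R), n%:R[ -> derivable f x 1}.
  have /= : {ae mu, forall x, forall n : nat, x \in `]-(n%:R), n%:R[ -> derivable f x 1}.
    exact/ae_foralln.
  apply: filterS; first exact: (ae_filter_ringOfSetsType mu).
  move=> x /(_ (Num.bound `|x|)); apply.
  by rewrite in_itv/= -ltr_norml; exact: archi_boundP.
pose a : R := - n%:R; pose b : R := n%:R.
have ab : a <= b by rewrite /a /b; have := ler0n R n; lra.
have mD : measurable (`]a, b]%classic : set (measurableTypeR R)) by exact: measurable_itv.
have nuD : (nu `]a, b]%classic < +oo)%E by rewrite nu_itv// ltry.
have dom : mfrestr mD nuD `<< mu.
  apply/null_content_dominatesP => A mA muA0.
  apply/eqP; rewrite eq_le measure_ge0 andbT -muA0 /mfrestr /mrestr.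
  apply: (le_trans (nu_le _ _)); first exact: measurableI.
  by apply: le_measure; rewrite ?inE//; exact: measurableI.
have [g [g0 gfin gint gE]] := radon_nikodym_sigma_finite dom.
pose gr := fine \o g.
have EgrE : EFin \o gr = g by apply/funext => x /=; rewrite fineK.
have igr : mu.-integrable setT (EFin \o gr) by rewrite EgrE.
have := lebesgue_differentiation (open_integrable_locally openT igr).
apply: filterS; first exact: (ae_filter_ringOfSetsType mu).
move=> x lx; rewrite in_itv/= => /andP[ax xb].
have iab : mu.-integrable [set` Interval (BRight a) (BRight b)] (EFin \o gr).
  exact: integrableS igr.
have [dx _] := FTC1_lebesgue_pt xb iab ax lx.
(* The integral of the density over []a, y]] is [F0 y - F0 a], and [f y = F0 y - y / 2];
   derivability at a Lebesgue point of the density thus passes to [f]. *)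
have nF : \forall y \near x, f y =
    Rintegral mu [set` Interval (BRight a) (BRight y)] gr + F0 a - y / 2.
  near=> y.
  have ay : a <= y by apply: ltW; near: y; exact: lt_nbhsr.
  have yb : y <= b by apply: ltW; near: y; exact: lt_nbhsl.
  rewrite /Rintegral (eq_integral g); last by move=> z _; rewrite /gr/= fineK.
  rewrite -(gE `]a, y]%classic); last exact: measurable_itv.
  rewrite [X in fine X](_ : _ = nu (`]a, y]%classic `&` `]a, b]%classic))//.
  rewrite setIidl; last by apply: subset_itvl; rewrite bnd_simp.
  by rewrite nu_itv//= /F0; lra.
have d2 := @derivable_add_affine _ _ (F0 a) 2^-1 _ dx.
apply: near_eq_derivable d2.
by apply: filterS nF => y ->.
Unshelve. all: by end_near.
Qed.

Lemma lipschitz_derivable_ae (R : realType) (f : R -> R) (k : R) :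
  (forall x y, `|f x - f y| <= k * `|x - y|) ->
  {ae lebesgue_measure, forall x, derivable f x 1}.
Proof.
(* The absolute value and the [+ 1] make [c] positive whatever [k] is; [f / c] then has Lipschitz
   constant 1/2. *)
move=> lf; pose c := 2 * (`|k| + 1).
have c0 : 0 < c by rewrite /c; have := normr_ge0 k; lra.
have : {ae lebesgue_measure, forall x, derivable (c^-1 \*: f) x 1}.
  apply: half_lipschitz_derivable_ae => x y.
  rewrite /= -scalerBr normrZ normfV gtr0_norm// ler_pdivrMl//.
  apply: (le_trans (lf x y)).
  have -> : c * (`|x - y| / 2) = (`|k| + 1) * `|x - y| by rewrite /c; field.
  by apply: ler_wpM2r => //; have := ler_norm k; lra.
apply: filterS; first exact: (ae_filter_ringOfSetsType lebesgue_measure).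
move=> x dx.
have -> : f = c \*: (c^-1 \*: f).
  by apply/funext => y /=; rewrite scalerA divff ?scale1r// gt_eqF.
exact: derivableZ.
Qed.

Lemma derivable1_expansion (R : realType) (f : R -> R) (x : R) :
  derivable f x 1 ->
  exists a : R, forall e : R, 0 < e -> exists2 d : R, 0 < d &
    forall h, `|h| <= d -> `|f (x + h) - f x - a * h| <= e * `|h|.
Proof.
move=> /cvg_ex[a /= /cvgrPdist_le fa]; exists a => e e0.
have [d /= d0 fd] := fa e e0.
exists (d / 2); first by rewrite divr_gt0.
move=> h hd; have [->|h0] := eqVneq h 0.
  by rewrite addr0 mulr0 subrr subr0 normr0 mulr0.
have /= := fd h; rewrite sub0r normrN => /(_ _ h0).
have -> : `|h| < d by apply: le_lt_trans hd _; rewrite ltr_pdivrMr//; lra.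
move=> /(_ isT).
rewrite [h *: 1]mulr1 [h + x]addrC => H.
have -> : f (x + h) - f x - a * h = - h * (a - h^-1 *: (f (x + h) - f x)).
  by rewrite /GRing.scale/=; field.
by rewrite normrM normrN mulrC ler_wpM2r.
Qed.

(** Removing an interval of radius [e * w] from one of radius [(1 + e) * w] leaves the proportion 1
    / (1 + e), which is at most 1 - e / 4 when [e <= 1]. *)
Lemma density_gap (R : realFieldType) (e w : R) : 0 <= e -> e <= 1 -> 0 <= w ->
  ((1 + e) * w) *+ 2 - (e * w) *+ 2 <= (1 - e / 4) * (((1 + e) * w) *+ 2).
Proof.
move=> e0 e1 w0; rewrite -subr_ge0 [leRHS](_ : _ = w * (e * (3 - e) / 2)); last by field.
by rewrite mulr_ge0 ?divr_ge0 ?mulr_ge0 ?subr_ge0//; lra.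
Qed.

(** Let x be a density point. If [A] missed the ball of radius e |h| around x + h, which lies in the
    ball of radius (1 + e) |h| around x, its density in the latter would be at most 1 - e / 4, which
    is impossible for small h. *)
Lemma density_approx_ae (R : realType) (A : set R) :
  measurable A ->
  {ae lebesgue_measure, forall x, A x ->
    forall e : R, 0 < e -> exists2 d : R, 0 < d &
      forall h, `|h| <= d -> exists2 h', A (x + h') & `|h' - h| <= e * `|h|}.
Proof.
move=> mA; have := lebesgue_density mA.
apply: filterS; first exact: (ae_filter_ringOfSetsType lebesgue_measure).
move=> x + Ax e e0.
have -> : \1_A x = 1 :> R by rewrite indicE mem_set.
move=> lim.
wlog e1 : e e0 / e <= 1.
  move=> W; have [||d d0 H] := W (Num.min e 1).
  - by rewrite lt_min e0 ltr01.
  - by rewrite ge_min lexx orbT.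
  exists d => // h /H[h' Ah' h'h]; exists h' => //.
  by apply: (le_trans h'h); rewrite ler_wpM2r// ge_min lexx.
have : \forall r \near 0^'+,
  ((1 - e / 4)%:E < lebesgue_measure (A `&` ball x r) / lebesgue_measure (ball x r))%E.
  apply: (lim [set y | ((1 - e / 4)%:E < y)%E]).
  by apply: (@nbhs_open_ereal_gt _ 1 (fun=> 1 - e / 4)); lra.
(* Since [e <= 1], the radius (1 + e) |h| is at most [d / 2], within the range of the density
   estimate. *)
move=> [d /= d0 H]; exists (d / 4); first by rewrite divr_gt0.
move=> h hd; have [->|h0] := eqVneq h 0.
  by exists 0; rewrite ?addr0// subrr normr0 mulr0.
have {}h0 : 0 < `|h| by rewrite normr_gt0.
pose r := (1 + e) * `|h|.
have r0 : 0 < r by rewrite mulr_gt0//; lra.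
have rd : r < d by rewrite /r; nra.
have /= := H r; rewrite sub0r normrN gtr0_norm// => /(_ rd r0).
rewrite lebesgue_measure_ball ?ltW//.
apply: contraPP => /forall2NP nA; apply/negP; rewrite -leNgt.
have r20 : 0 < r *+ 2 by rewrite mulrn_wgt0.
rewrite inver gt_eqF// lee_pdivrMr//.
have mB z s : measurable (ball z s : set R) by exact: measurable_ball.
have dj : (A `&` ball x r) `&` ball (x + h) (e * `|h|) = set0.
  apply/seteqP; split=> // z [[Az _]]; rewrite /ball/= => zh.
  have [|] := nA (z - x); first by rewrite addrC subrK.
  have E (u v w : R) : - (w - u - v) = u + v - w by ring.
  by apply; rewrite -normrN E ltW.
have sub : (A `&` ball x r) `|` ball (x + h) (e * `|h|) `<=` ball x r.
  move=> z [[]//|]; rewrite /ball/= => zh.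
  have E (u v w : R) : u - w = (u + v - w) - v by ring.
  rewrite (E x h z).
  by rewrite (le_lt_trans (ler_normB _ _))// /r; lra.
have mAB := measurableI _ _ mA (mB x r).
have : (lebesgue_measure (A `&` ball x r) + lebesgue_measure (ball (x + h)%R (e * `|h|)%R)
        <= lebesgue_measure (ball x r))%E.
  have <- : lebesgue_measure ((A `&` ball x r) `|` ball (x + h)%R (e * `|h|)%R) =
    (lebesgue_measure (A `&` ball x r) + lebesgue_measure (ball (x + h)%R (e * `|h|)%R))%E.
    by rewrite measureU//; exact: mB.
  apply: le_measure; rewrite ?inE//; (exact: mB || exact: (measurableU _ _ mAB (mB _ _))).
rewrite (lebesgue_measure_ball _ (ltW r0)) lebesgue_measure_ball; last first.
  by rewrite ltW// mulr_gt0.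
rewrite -leeBrDr// -EFinB => /le_trans; apply.
by rewrite -EFinM lee_fin; apply: density_gap => //; exact: ltW.
Qed.

(** * Rademacher's theorem *)

Fixpoint eucl_of (R : realType) (n : nat) (g : nat -> R) : eucl R n :=
  match n return eucl R n with
  | 0 => tt
  | m.+1 => (g 0, eucl_of m (fun i => g i.+1))
  end.

Lemma eucl_nth_of (R : realType) n (g : nat -> R) i :
  (i < n)%N -> eucl_nth (eucl_of n g) i = g i.
Proof. by elim: n g i => [//|n IH] g [//|i] /= /(IH (g \o S)). Qed.

Lemma measurable_eucl_nth (R : realType) n i :
  measurable_fun setT (fun t : eucl R n => eucl_nth t i : R).
Proof.
elim: n i => [|n IH] [|i] /=; [exact: measurable_cst..| |].
  exact: measurable_fst.
by apply: (measurableT_comp (IH i)); exact: measurable_snd.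
Qed.

Lemma measurable_eucl_of (R : realType) d (T : measurableType d) n (g : T -> nat -> R) :
  (forall i, measurable_fun setT (g^~ i)) ->
  measurable_fun setT (fun t => eucl_of n (g t)).
Proof.
elim: n g => [|n IH] g mg /=; first exact: measurable_cst.
apply: measurable_fun_pair; first exact: mg.
by apply: IH => i; exact: mg.
Qed.

Lemma eq_eucl_of (R : realType) n (g h : nat -> R) :
  (forall i, (i < n)%N -> g i = h i) -> eucl_of n g = eucl_of n h.
Proof.
elim: n g h => [//|n IH] g h gh /=; congr pair; first exact: gh.
by apply: IH => i ?; exact: gh.
Qed.

Lemma eucl_of_nth (R : realType) n (t : eucl R n) : eucl_of n (eucl_nth t) = t.
Proof. by elim: n t => [[]//|n IH] [x y] /=; congr pair; exact: IH. Qed.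

(** [eucl R n] serves as a measurable space only, so increments are plain sequences, of which the
    first [n] terms count. *)
Definition eshift (R : realType) n (t : eucl R n) (v : nat -> R) : eucl R n :=
  eucl_of n (fun i => eucl_nth t i + v i).

Lemma eshift_pair (R : realType) n (x : R) (y : eucl R n) (v : nat -> R) :
  eshift ((x, y) : eucl R n.+1) v = (x + v 0, eshift y (v \o S)).
Proof. by []. Qed.

Lemma eshift0 (R : realType) n (t : eucl R n) : eshift t (fun=> 0) = t.
Proof. by rewrite -[RHS]eucl_of_nth; apply: eq_eucl_of => i _; rewrite addr0. Qed.

Definition l1norm (R : realType) n (v : nat -> R) : R := \sum_(i < n) `|v i|.

Definition dot_prod (R : realType) n (a v : nat -> R) : R := \sum_(i < n) a i * v i.

(** Sequences of rationals form a countable type common to all dimensions; missing entries read as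
    0. *)
Definition rat_vec (R : realType) (q : seq rat) (i : nat) : R := ratr q`_i.

Definition l1_lipschitz (R : realType) n (k : R) (f : eucl R n -> R) :=
  forall s t, `|f s - f t| <= k * l1norm n (fun i => eucl_nth s i - eucl_nth t i).

Lemma l1norm_ge0 (R : realType) n (v : nat -> R) : 0 <= l1norm n v.
Proof. exact: sumr_ge0. Qed.

Lemma l1normS (R : realType) n (v : nat -> R) :
  l1norm n.+1 v = `|v 0| + l1norm n (v \o S).
Proof. by rewrite /l1norm big_ord_recl. Qed.

Lemma dot_prodS (R : realType) n (a v : nat -> R) :
  dot_prod n.+1 a v = a 0 * v 0 + dot_prod n (a \o S) (v \o S).
Proof. by rewrite /dot_prod big_ord_recl. Qed.

Lemma eq_l1norm (R : realType) n (u v : nat -> R) :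
  (forall i, (i < n)%N -> `|u i| = `|v i|) -> l1norm n u = l1norm n v.
Proof. by move=> uv; apply: eq_bigr => i _; exact: uv. Qed.

Lemma rat_dense_ball (R : realType) (x e : R) : 0 < e -> exists q : rat, `|x - ratr q| <= e.
Proof.
move=> e0; have [q] : exists q, ratr q \in `]x - e, x + e[.
  by apply: rat_in_itvoo; lra.
rewrite in_itv/= => /andP[q1 q2]; exists q; rewrite ler_norml; lra.
Qed.

Lemma rat_vec_dense (R : realType) n (v : nat -> R) (e : R) :
  0 < e -> exists q, l1norm n (fun i => v i - rat_vec R q i) <= e.
Proof.
elim: n v e => [|n IH] v e e0.
  by exists [::]; rewrite /l1norm big_ord0 ltW.
have e20 : 0 < e / 2 by rewrite divr_gt0.
have [p pv] := rat_dense_ball (v 0) e20.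
have [q qv] := IH (v \o S) _ e20.
exists (p :: q); rewrite l1normS [leRHS]splitr lerD//.
Qed.

(** * Measurability of Lipschitz functions and of differentiability sets *)

Lemma bigcap_countable_measurable d (T : measurableType d) (I : countType)
    (P : set I) (F : I -> set T) :
  (forall i, P i -> measurable (F i)) -> measurable (\bigcap_(i in P) F i).
Proof.
move=> mF.
have -> : \bigcap_(i in P) F i =
    \bigcap_n (if unpickle n is Some i then if `[< P i >] then F i else setT else setT).
  apply/seteqP; split => [t Ft n _|t Ft i Pi].
    by case: unpickle => // i; case: asboolP => // Pi; exact: Ft.
  by have := Ft (pickle i) Logic.I; rewrite pickleK; case: asboolP.
apply: bigcapT_measurable => n; case: unpickle => // i.
by case: asboolP => // Pi; exact: mF.
Qed.

Lemma bigcup_countable_measurable d (T : measurableType d) (I : countType)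
    (P : set I) (F : I -> set T) :
  (forall i, P i -> measurable (F i)) -> measurable (\bigcup_(i in P) F i).
Proof.
move=> mF; rewrite -[X in measurable X]setCK setC_bigcup; apply: measurableC.
by apply: bigcap_countable_measurable => i Pi; apply: measurableC; exact: mF.
Qed.

(** [f] is the infimum of the cones [g q] with rational apex: each lies above [f] by the Lipschitz
    bound, and an apex close to [t] gives a value close to [f t]. Sublevel sets of [f] are thus
    countable unions of sublevel sets of cones. *)
Lemma l1_lipschitz_measurable (R : realType) n (k : R) (f : eucl R n -> R) :
  l1_lipschitz k f -> measurable_fun setT f.
Proof.
move=> lf mT; apply: (measurability _ (RGenInftyO.measurableE R)) => // _ [_ [a ->] <-].
rewrite setTI.
pose g (q : seq rat) (t : eucl R n) := f (eucl_of n (rat_vec R q)) +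
  k * l1norm n (fun i => eucl_nth t i - rat_vec R q i).
have -> : f @^-1` `]-oo, a[ = \bigcup_(q in setT) [set t | g q t < a].
  apply/seteqP; split => [t /=|t [q _ /=]]; rewrite in_itv/=.
    (* With N the distance from t to the apex, [g q t] exceeds [f t] by at most 2 |k| N, which this
       choice keeps below half of [a - f t]. *)
    move=> fta; have e0 : 0 < (a - f t) / (4 * (`|k| + 1)).
      by rewrite divr_gt0 ?subr_gt0// mulr_gt0// ltr_wpDl.
    have [q tq] := rat_vec_dense n (eucl_nth t) e0; exists q => //=.
    have := lf (eucl_of n (rat_vec R q)) t.
    rewrite (eq_l1norm (v := fun i => eucl_nth t i - rat_vec R q i)); last first.
      by move=> i ?; rewrite eucl_nth_of// distrC.
    move: tq; rewrite /g; set N := l1norm n _; set fq := f (eucl_of _ _).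
    have N0 : 0 <= N by exact: l1norm_ge0.
    rewrite ler_pdivlMr ?mulr_gt0 ?ltr_wpDl// ler_norml => tq /andP[_ H].
    have kN : k * N <= `|k| * N by rewrite ler_wpM2r// ler_norm.
    have kN0 : 0 <= `|k| * N by rewrite mulr_ge0.
    by move: tq; rewrite mulrDr mulr1 mulrDr mulrCA [N * _]mulrC; lra.
  rewrite /g => gt; have := lf t (eucl_of n (rat_vec R q)).
  rewrite (eq_l1norm (v := fun i => eucl_nth t i - rat_vec R q i)); last first.
    by move=> i ?; rewrite eucl_nth_of.
  rewrite ler_norml => /andP[_]; lra.
apply: bigcup_countable_measurable => q _.
have mg : measurable_fun setT (g q).
  apply: measurable_funD; first exact: measurable_cst.
  apply: measurable_funM; first exact: measurable_cst.
  apply: measurable_sum => i; apply: measurableT_comp => //.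
  by apply: measurable_funB; [exact: measurable_eucl_nth|exact: measurable_cst].
have := measurable_fun_ltr mg (measurable_cst a).
by move=> /(_ measurableT [set true]); rewrite setTI; exact.
Qed.

(* Only rational directions in [S], slopes and moduli occur, so that
   [rat_diff S f] is obtained from measurable sets by countable operations.
   [S = setT] gives differentiability; vectors with a zero first component, or
   with only the first one nonzero, give differentiability in [y] or in [x]
   of a function of [(x, y)]. *)
Definition good_at (R : realType) n (S : set (seq rat)) (f : eucl R n -> R)
    (k : nat) (l : seq rat) (j : nat) : set (eucl R n) :=
  [set t | forall q, S q -> l1norm n (rat_vec R q) <= j.+1%:R^-1 ->
    `|f (eshift t (rat_vec R q)) - f t - dot_prod n (rat_vec R l) (rat_vec R q)|
      <= k.+1%:R^-1 * l1norm n (rat_vec R q)].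

Definition rat_diff (R : realType) n (S : set (seq rat)) (f : eucl R n -> R) :
    set (eucl R n) :=
  \bigcap_(k : nat) \bigcup_(lj : seq rat * nat) good_at S f k lj.1 lj.2.

Lemma measurable_good_at (R : realType) n S (f : eucl R n -> R) k l j :
  measurable_fun setT f -> measurable (good_at S f k l j).
Proof.
move=> mf.
have -> : good_at S f k l j =
  \bigcap_(q in [set q | S q /\ l1norm n (rat_vec R q) <= j.+1%:R^-1])
  [set t | `|f (eshift t (rat_vec R q)) - f t - dot_prod n (rat_vec R l) (rat_vec R q)|
      <= k.+1%:R^-1 * l1norm n (rat_vec R q)].
  by apply/seteqP; split => [t H q [? ?]|t H q ? ?]; exact: H.
apply: bigcap_countable_measurable => q _.
have mg : measurable_fun setT (fun t =>
    `|f (eshift t (rat_vec R q)) - f t - dot_prod n (rat_vec R l) (rat_vec R q)|).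
  apply: measurableT_comp => //; apply: measurable_funB; last exact: measurable_cst.
  apply: measurable_funB => //; apply: (measurableT_comp mf).
  apply: measurable_eucl_of => i.
  by apply: measurable_funD; [exact: measurable_eucl_nth|exact: measurable_cst].
have := measurable_fun_ler mg (measurable_cst (k.+1%:R^-1 * l1norm n (rat_vec R q))).
by move=> /(_ measurableT [set true]); rewrite setTI; exact.
Qed.

Lemma measurable_rat_diff (R : realType) n S (f : eucl R n -> R) :
  measurable_fun setT f -> measurable (rat_diff S f).
Proof.
move=> mf; apply: bigcapT_measurable => k.
by apply: bigcup_countable_measurable => lj _; exact: measurable_good_at.
Qed.

Lemma rat_diff_fst (R : realType) n (f : eucl R n.+1 -> R) (x : R) (y : eucl R n) :
  rat_diff setT (fun y => f (x, y)) y -> rat_diff [set q | q`_0 = 0] f (x, y).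
Proof.
move=> H k _; have [[l j] _ /= G] := H k Logic.I.
exists (0 :: l, j) => //= q /= q0.
have r0 : rat_vec R q 0 = 0 by rewrite /rat_vec q0 raddf0.
have rS : rat_vec R q \o S = rat_vec R (behead q).
  by apply/funext => i; rewrite /rat_vec /= nth_behead.
rewrite l1normS dot_prodS r0 rS normr0 add0r mulr0 add0r => qj.
have := G (behead q) Logic.I qj.
by rewrite /eshift /= r0 addr0 -rS.
Qed.

Lemma rat_diff_derivable (R : realType) n (f : eucl R n.+1 -> R) (x : R) (y : eucl R n) :
  derivable (fun x => f (x, y)) x 1 ->
  rat_diff [set q | forall i, q`_i.+1 = 0] f (x, y).
Proof.
move=> /derivable1_expansion[a fa] k _.
(* Half of the tolerance pays for the expansion, half for rounding the slope [a] to a rational. *)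
have e0 : 0 < (k.+1%:R^-1 : R) / 2 by rewrite divr_gt0// invr_gt0.
have [d d0 fd] := fa _ e0.
have [l al] := rat_dense_ball a e0.
pose j := Num.bound d^-1.
have jd : (j.+1%:R^-1 : R) <= d.
  rewrite -[leRHS]invrK lef_pV2 ?posrE ?invr_gt0//.
  have := archi_boundP (ltW (etrans (invr_gt0 d) d0)).
  by rewrite -/j -natr1; lra.
exists ([:: l], j) => //= q /= q0.
have rS i : rat_vec R q i.+1 = 0 by rewrite /rat_vec q0 raddf0.
have lS : l1norm n (rat_vec R q \o S) = 0.
  by rewrite /l1norm big1// => i _; rewrite /= rS normr0.
have dS : dot_prod n (rat_vec R [:: l] \o S) (rat_vec R q \o S) = 0.
  by rewrite /dot_prod big1// => i _; rewrite /= rS mulr0.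
have -> : eshift ((x, y) : eucl R n.+1) (rat_vec R q) = (x + rat_vec R q 0, y).
  rewrite /eshift /=; congr pair.
  rewrite -[RHS]eucl_of_nth; apply: eq_eucl_of => i _.
  by rewrite rS addr0.
rewrite l1normS dot_prodS lS dS !addr0 => qj.
have := fd _ (le_trans qj jd).
set h := rat_vec R q 0; set F := f _; set F0 := f _ => H.
have -> : F - F0 - rat_vec R [:: l] 0 * h = (F - F0 - a * h) + (a - ratr l) * h.
  by rewrite /rat_vec/=; ring.
rewrite (le_trans (ler_normD _ _))// [k.+1%:R^-1]splitr [leRHS]mulrDl lerD//.
by rewrite normrM ler_wpM2r.
Qed.

(* One point of the section of [good_at] that is close to [x + h] gives the
   increment of [f] along [y]; the increment along [x] is the partial
   derivative at [(x, y)] itself. *)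
Lemma rat_diff_of_density (R : realType) n (K : R) (f : eucl R n.+1 -> R) (x : R) (y : eucl R n) :
  l1_lipschitz K f ->
  rat_diff [set q | q`_0 = 0] f (x, y) ->
  rat_diff [set q | forall i, q`_i.+1 = 0] f (x, y) ->
  (forall k l j, good_at [set q | q`_0 = 0] f k l j (x, y) ->
    forall e : R, 0 < e -> exists2 d : R, 0 < d &
      forall h, `|h| <= d -> exists2 h',
        good_at [set q | q`_0 = 0] f k l j (x + h', y) & `|h' - h| <= e * `|h|) ->
  rat_diff setT f (x, y).
Proof.
move=> lf D1 D2 dens k _.
(* The coefficient of |h| in the final error: twice |K| for moving between x + h and x + h', once 1
   for the expansion along x. The index [k'] is taken so large that [eta * c] is within the
   tolerance. *)
pose c := 2 * `|K| + 1.
have c1 : 1 <= c by rewrite /c; have := normr_ge0 K; lra.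
pose k' := (k.+1 * (Num.bound c).+1)%N.
pose eta : R := k'.+1%:R^-1.
have etac : eta * c <= k.+1%:R^-1.
  rewrite /eta mulrC ler_pdivrMr// mulrC ler_pdivlMr//.
  have cB : c <= (Num.bound c)%:R by apply/ltW/archi_boundP; lra.
  have k0 : 0 <= k.+1%:R :> R by [].
  apply: le_trans (_ : (Num.bound c)%:R * k.+1%:R <= _).
    by rewrite ler_wpM2r.
  by rewrite -natrM ler_nat /k' mulnC leqW// leq_pmul2l// leqW.
have eta0 : 0 < eta by rewrite invr_gt0.
have [[l1 j1] _ /= G1] := D1 k' Logic.I.
have [[l2 j2] _ /= G2] := D2 k' Logic.I.
have [d d0 Hd] := dens _ _ _ G1 _ eta0.
pose j3 := Num.bound d^-1.
have jd : (j3.+1%:R^-1 : R) <= d.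
  rewrite -[leRHS]invrK lef_pV2 ?posrE ?invr_gt0//.
  have := archi_boundP (ltW (etrans (invr_gt0 d) d0)).
  by rewrite -/j3 -natr1; lra.
pose j := maxn j3 (maxn j1 j2).
have jle i : (i <= j)%N -> (j.+1%:R^-1 : R) <= i.+1%:R^-1.
  by move=> ij; rewrite lef_pV2 ?posrE// ler_nat.
(* The slope along x comes from the expansion of [f] in x, the others from the expansion in y. *)
exists (l2`_0 :: behead l1, j) => //= q _ qj.
pose h := rat_vec R q 0; pose v := rat_vec R q \o S.
have hq : rat_vec R [:: q`_0] 0 = h by [].
have vq : rat_vec R (0 :: behead q) \o S = v.
  by apply/funext => i; rewrite /v /rat_vec /= nth_behead.
have h0 : rat_vec R (0 :: behead q) 0 = 0 by rewrite /rat_vec /= raddf0.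
have v0 : rat_vec R [:: q`_0] \o S = fun=> 0.
  by apply/funext => i; rewrite /rat_vec /= nth_nil raddf0.
have N0 : l1norm n (fun=> 0 : R) = 0 by rewrite /l1norm big1// => i _; rewrite normr0.
have P0 a : dot_prod n a (fun=> 0 : R) = 0 by rewrite /dot_prod big1// => i _; rewrite mulr0.
have qS : l1norm n.+1 (rat_vec R q) = `|h| + l1norm n v by rewrite l1normS.
have v_ge0 := l1norm_ge0 n v.
have hd : `|h| <= d.
  apply: le_trans jd; apply: le_trans (jle j3 (leq_maxl _ _)).
  by apply: le_trans qj; rewrite qS lerDl.
have [h' Gh' h'h] := Hd h hd.
have E1 := Gh' (0 :: behead q) erefl.
have E2 := G2 [:: q`_0].
move: E1 E2; rewrite !l1normS !dot_prodS hq vq h0 v0 N0 !P0.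
rewrite normr0 add0r mulr0 add0r !addr0 => E1 E2.
have {}E1 := E1 _; have {}E2 := E2 _ _.
move: E1 => /(_ _)/wrap[|E1].
  apply: le_trans (jle j1 _); last by rewrite leq_max leq_max leqnn orbT.
  by apply: le_trans qj; rewrite qS lerDr.
move: E2 => /(_ _ _)/wrap[||E2].
- by move=> i /=; rewrite nth_nil.
- apply: le_trans (jle j2 _); last by rewrite !leq_max leqnn !orbT.
  by apply: le_trans qj; rewrite qS lerDl.
rewrite -/h -/v.
have -> : rat_vec R (l2`_0 :: behead l1) 0 = rat_vec R l2 0 by [].
have -> : rat_vec R (l2`_0 :: behead l1) \o S = rat_vec R l1 \o S.
  by apply/funext => i; rewrite /rat_vec /= nth_behead.
move: E1 E2; rewrite !eshift_pair vq h0 v0 eshift0 hq addr0 -/h -/v -/eta.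
set a := rat_vec R l2 0; set D := dot_prod n _ _.
set y' := eshift y v.
have L z : `|f (x + h, z) - f (x + h', z)| <= `|K| * eta * `|h|.
  apply: le_trans (lf _ _) _; rewrite l1normS /=.
  rewrite (eq_l1norm (v := fun=> 0)) ?N0 ?addr0; last by move=> i _ /=; rewrite subrr.
  rewrite opprD addrACA subrr add0r distrC -mulrA.
  apply: le_trans (ler_wpM2r (normr_ge0 _) (ler_norm K)) _.
  by rewrite ler_wpM2l.
have := L y; have := L y'.
set F1 := f (x + h, y'); set F2 := f (x + h', y'); set F3 := f (x + h, y).
set F4 := f (x + h', y); set F0 := f (x, y) => L1 L2 E1 E2.
(* Go from (x + h, y') across to (x + h', y'), along y to (x + h', y), back to (x + h, y), and along
   x to (x, y). *)
have -> : F1 - F0 - (a * h + D) =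
    (F1 - F2) + (F2 - F4 - D) + (- (F3 - F4)) + (F3 - F0 - a * h) by ring.
apply: le_trans (_ : `|K| * eta * `|h| + eta * l1norm n v + `|K| * eta * `|h| + eta * `|h| <= _).
  rewrite (le_trans (ler_normD _ _))// lerD//.
  rewrite (le_trans (ler_normD _ _))// lerD ?normrN//.
  by rewrite (le_trans (ler_normD _ _))// lerD.
have -> : `|K| * eta * `|h| + eta * l1norm n v + `|K| * eta * `|h| + eta * `|h| =
   eta * c * `|h| + eta * l1norm n v by rewrite /c; ring.
rewrite [leRHS]mulrDr lerD ?ler_wpM2r//.
by apply: le_trans etac; rewrite ler_peMr// ltW.
Qed.

(** * Null sets of product measures and the induction on the dimension *)

Lemma product_measure_null_xsection d1 d2 (T1 : measurableType d1)
    (T2 : measurableType d2) (R : realType)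
    (m1 : {sigma_finite_measure set T1 -> \bar R})
    (m2 : {sigma_finite_measure set T2 -> \bar R}) (A : set (T1 * T2)) :
  (forall x, m2 (xsection A x) = 0%E) -> (m1 \x m2)%E A = 0%E.
Proof. by move=> A0; rewrite /product_measure1; apply: integral0_eq => x _ /=; exact: A0. Qed.

(** [m1 \x m2] integrates the measures of the x-sections. It coincides with [m1 \x^ m2], which
    integrates over the y-sections, because both agree on rectangles. *)
Lemma product_measure_null_ysection d1 d2 (T1 : measurableType d1)
    (T2 : measurableType d2) (R : realType)
    (m1 : {sigma_finite_measure set T1 -> \bar R})
    (m2 : {sigma_finite_measure set T2 -> \bar R}) (A : set (T1 * T2)) :
  measurable A -> (forall y, m1 (ysection A y) = 0%E) -> (m1 \x m2)%E A = 0%E.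
Proof.
move=> mA A0.
have -> : (m1 \x m2)%E A = (m1 \x^ m2)%E A.
  apply: (product_measure_unique (m' := (m1 \x^ m2)%E)) => // B C mB mC.
  exact: product_measure2E.
by rewrite /product_measure2; apply: integral0_eq => x _ /=; exact: A0.
Qed.

Lemma ae_forall_countable d (T : measurableType d) (R : realType) (I : countType)
    (mu : {measure set T -> \bar R}) (P : I -> T -> Prop) :
  (forall i, {ae mu, forall x, P i x}) -> {ae mu, forall x, forall i, P i x}.
Proof.
move=> aeP.
have : {ae mu, forall x, forall n, if unpickle n is Some i then P i x else True}.
  by apply: ae_foralln => n; case: unpickle => // ; exact: aeW.
move=> [N [mN N0 sN]]; exists N; split => // x nx; apply: sN => /= H; apply: nx => i.
by have := H (pickle i); rewrite pickleK.
Qed.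

Theorem rademacher_rat_diff (R : realType) n (K : R) (f : eucl R n -> R) :
  l1_lipschitz K f -> euclidean_lebesgue R n (~` rat_diff setT f) = 0%E.
Proof.
elim: n f => [|n IH] f lf.
  rewrite (_ : ~` _ = set0) ?measure0//; apply/seteqP; split => // t; apply.
  move=> k _; exists ([::], 0) => //= q _ _.
  by rewrite /eshift /dot_prod /l1norm /= !big_ord0; case: t; rewrite subrr subr0 normr0 mulr0.
have mf := l1_lipschitz_measurable lf.
(* Points where differentiability along y fails; every section at fixed x is null by induction. *)
pose Z := ~` rat_diff [set q | q`_0 = 0] f.
have mZ : measurable Z by apply: measurableC; exact: measurable_rat_diff.
pose B := ~` rat_diff setT f.
have mB : measurable B by apply: measurableC; exact: measurable_rat_diff.
have lfx x : l1_lipschitz K (fun y : eucl R n => f (x, y)).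
  by move=> s t; apply: le_trans (lf _ _) _; rewrite l1normS /= subrr normr0 add0r.
have lfy (y : eucl R n) u v : `|f (u, y) - f (v, y)| <= K * `|u - v|.
  apply: le_trans (lf _ _) _; rewrite l1normS /= (_ : l1norm n _ = 0) ?addr0//.
  by rewrite /l1norm big1// => i _; rewrite /= subrr normr0.
have Z0 : euclidean_lebesgue R n.+1 Z = 0%E.
  apply: product_measure_null_xsection => x.
  apply/eqP; rewrite eq_le measure_ge0 andbT -(IH _ (lfx x)).
  apply: le_measure; rewrite ?inE.
  - exact: measurable_xsection.
  - by apply/measurableC/measurable_rat_diff/l1_lipschitz_measurable/lfx.
  - move=> y; rewrite /xsection/= inE /Z /=; apply: contra_not.
    exact: rat_diff_fst.
(* Outside [Z], fix y: for almost every x, [f] is derivable in x and x is approximable within each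
   of the countably many sections of [good_at] that contain it. *)
have BZ0 : euclidean_lebesgue R n.+1 (B `\` Z) = 0%E.
  apply: product_measure_null_ysection; first exact: measurableD.
  move=> y; apply: measure_negligible.
    by apply: measurable_ysection; exact: measurableD.
  have d1 := lipschitz_derivable_ae (lfy y).
  pose A k l j := [set x : R | good_at [set q | q`_0 = 0] f k l j (x, y)].
  have mA k l j : measurable (A k l j).
    have := measurable_ysection y (measurable_good_at [set q : seq rat | q`_0 = 0] k l j mf).
    by rewrite ysectionE.
  have d2 : {ae lebesgue_measure, forall x, forall i : nat * seq rat * nat,
      A i.1.1 i.1.2 i.2 x -> forall e : R, 0 < e -> exists2 d : R, 0 < d &
      forall h, `|h| <= d -> exists2 h', A i.1.1 i.1.2 i.2 (x + h') & `|h' - h| <= e * `|h|}.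
    by apply: ae_forall_countable => i; exact: density_approx_ae.
  apply: negligibleS (negligibleU (d1 : _.-negligible _) (d2 : _.-negligible _)).
  move=> x; rewrite /ysection/= inE => -[Bxy /contrapT D1].
  apply: contrapT => /not_orP[/contrapT Dx /contrapT Ax].
  apply: Bxy; apply: (rat_diff_of_density lf D1); first exact: rat_diff_derivable.
  by move=> k l j; exact: (Ax (k, l, j)).
apply: measure_negligible => //.
apply: (@negligibleS _ _ _ _ (Z `|` (B `\` Z))).
  by move=> t Bt; have [Zt|nZt] := pselect (Z t); [left|right].
apply: negligibleU; apply/negligibleP => //; exact: measurableD.
Qed.

(** * From rational increments to a real expansion *)

Lemma ler_norm_dot_prod (R : realType) n (a v : nat -> R) (c : R) :
  (forall i, (i < n)%N -> `|a i| <= c) -> `|dot_prod n a v| <= c * l1norm n v.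
Proof.
move=> ac; apply: le_trans (ler_norm_sum _ _ _) _; rewrite mulr_sumr.
by apply: ler_sum => i _; rewrite normrM ler_wpM2r// ac.
Qed.

Lemma dot_prodB (R : realType) n (a b v : nat -> R) :
  dot_prod n a v - dot_prod n b v = dot_prod n (fun i => a i - b i) v.
Proof. by rewrite /dot_prod -sumrB; apply: eq_bigr => i _; rewrite mulrBl. Qed.

Lemma dot_prodBr (R : realType) n (a v w : nat -> R) :
  dot_prod n a v - dot_prod n a w = dot_prod n a (fun i => v i - w i).
Proof. by rewrite /dot_prod -sumrB; apply: eq_bigr => i _; rewrite mulrBr. Qed.

Lemma l1norm_delta (R : realType) n (i : 'I_n) (c : R) :
  l1norm n (fun j => if j == i then c else 0) = `|c|.
Proof.
rewrite /l1norm (bigD1 i)//= eqxx big1 ?addr0// => j ji.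
by rewrite (negbTE (_ : val j != val i)) ?normr0.
Qed.

Lemma dot_prod_delta (R : realType) n (i : 'I_n) (a : nat -> R) (c : R) :
  dot_prod n a (fun j => if j == i then c else 0) = a i * c.
Proof.
rewrite /dot_prod (bigD1 i)//= eqxx big1 ?addr0// => j ji.
by rewrite (negbTE (_ : val j != val i)) ?mulr0.
Qed.

(** Approximate [v] by a rational vector; [f] and the dot product are both Lipschitz in the
    increment. The strict bound on [v] leaves room for the approximation to stay in the range of
    [good_at]. *)
Lemma good_at_real (R : realType) n (K : R) (f : eucl R n -> R) k l j t (v : nat -> R) :
  l1_lipschitz K f -> good_at setT f k l j t -> l1norm n v < j.+1%:R^-1 ->
  `|f (eshift t v) - f t - dot_prod n (rat_vec R l) v| <= k.+1%:R^-1 * l1norm n v.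
Proof.
move=> lf G vj; apply/ler_addgt0Pr => e e0.
pose M := l1norm n (rat_vec R l).
have M0 : 0 <= M by exact: l1norm_ge0.
pose c := `|K| + M + 1.
have c0 : 0 < c by rewrite /c; have := normr_ge0 K; lra.
(* The first bound keeps [q] in the range of [good_at], the second makes the total error at most
   [e]. *)
pose eta := Num.min (j.+1%:R^-1 - l1norm n v) (e / c).
have eta0 : 0 < eta by rewrite lt_min subr_gt0 vj divr_gt0.
have [q qv] := rat_vec_dense n v eta0.
set N := l1norm n _ in qv.
have qN : l1norm n (rat_vec R q) <= l1norm n v + N.
  rewrite /N /l1norm -big_split/=; apply: ler_sum => i _.
  by rewrite -{1}(subKr (v i) (rat_vec R q i)) (le_trans (ler_normB _ _)).
have Nc : N * c <= e.
  by rewrite -ler_pdivlMr//; apply: le_trans qv _; rewrite ge_min lexx orbT.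
have N0 : 0 <= N by exact: l1norm_ge0.
have qj : l1norm n (rat_vec R q) <= j.+1%:R^-1.
  apply: le_trans qN _; rewrite -lerBrDl; apply: le_trans qv _.
  by rewrite ge_min lexx.
have H := G q Logic.I qj.
have H1 : `|f (eshift t v) - f (eshift t (rat_vec R q))| <= `|K| * N.
  apply: le_trans (lf _ _) _; rewrite (eq_l1norm (v := fun i => v i - rat_vec R q i)).
    by rewrite ler_wpM2r// ler_norm.
  by move=> i ?; rewrite !eucl_nth_of// opprD addrACA subrr add0r.
have H2 : `|dot_prod n (rat_vec R l) v - dot_prod n (rat_vec R l) (rat_vec R q)| <= M * N.
  rewrite dot_prodBr; apply: ler_norm_dot_prod => i iltn.
  by rewrite /M /l1norm (bigD1 (Ordinal iltn))//= lerDl sumr_ge0.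
have k1 : k.+1%:R^-1 <= 1 :> R by rewrite invf_le1// ler1n.
have k0 : 0 <= k.+1%:R^-1 :> R by rewrite invr_ge0.
have kN : k.+1%:R^-1 * N <= N by rewrite ler_piMl.
have kq : k.+1%:R^-1 * l1norm n (rat_vec R q) <= k.+1%:R^-1 * l1norm n v + k.+1%:R^-1 * N.
  by rewrite -mulrDr ler_wpM2l.
set F1 := f (eshift t v) in H1 *; set F2 := f (eshift t _) in H H1.
set D1 := dot_prod n _ v in H2 *; set D2 := dot_prod n _ _ in H H2.
rewrite (_ : _ - _ = (F1 - F2) + (F2 - f t - D2) - (D1 - D2)); last by ring.
rewrite (le_trans (ler_normB _ _))//.
apply: le_trans (lerD (ler_normD _ _) H2) _.
apply: le_trans (lerD (lerD H1 H) (lexx _)) _.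
have Nc' : `|K| * N + M * N + N <= e.
  by apply: le_trans Nc; rewrite le_eqVlt /c (_ : _ == _ = true)//; apply/eqP; ring.
move: Nc' kN kq.
move: (`|K| * N) (M * N) (k.+1%:R^-1 * N) (k.+1%:R^-1 * l1norm n _) (k.+1%:R^-1 * l1norm n v).
by move=> a1 a2 a3 a4 a5; lra.
Qed.

Lemma half_min_lt (R : realFieldType) (a b : R) : 0 < a -> 0 < b ->
  [/\ 0 < Num.min a b / 2, Num.min a b / 2 < a & Num.min a b / 2 < b].
Proof. by move=> a0 b0; have [ab|ba] := leP a b; split; lra. Qed.

(** The intervals [u k - a k, u k + a k] meet pairwise, so the supremum of their left endpoints lies
    in all of them. *)
Lemma cauchy_bounds_limit (R : realType) (u a : nat -> R) :
  (forall k k', `|u k - u k'| <= a k + a k') ->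
  exists l, forall k, `|u k - l| <= a k.
Proof.
move=> ua; exists (sup (range (fun k => u k - a k))) => k.
have ub k' : ubound (range (fun k => u k - a k)) (u k' + a k').
  by move=> _ [m _ <-]; have := ua m k'; rewrite ler_norml; lra.
rewrite ler_norml; apply/andP; split.
  rewrite lerBrDl -lerBrDr opprK.
  by apply: ge_sup (ub k); exists (u 0 - a 0), 0.
rewrite lerBlDl -lerBlDr; apply: ub_le_sup; last by exists k.
by exists (u 0 + a 0); exact: ub.
Qed.

(** The rational slopes found for two tolerances, tested on one common increment along each axis,
    differ by at most the sum of the tolerances; hence a single real slope lies within each
    tolerance of them. *)
Lemma rat_diff_expansion (R : realType) n (K : R) (f : eucl R n -> R) t :
  l1_lipschitz K f -> rat_diff setT f t ->
  exists l : nat -> R, forall e : R, 0 < e -> exists2 d : R, 0 < d &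
    forall v, l1norm n v <= d ->
      `|f (eshift t v) - f t - dot_prod n l v| <= e * l1norm n v.
Proof.
move=> lf D.
have /choice[lj Hlj] : forall k, exists lj : seq rat * nat, good_at setT f k lj.1 lj.2 t.
  by move=> k; have [lj _ G] := D k Logic.I; exists lj.
pose a k i := rat_vec R (lj k).1 i.
have ca (i : 'I_n) k k' : `|a k i - a k' i| <= k.+1%:R^-1 + k'.+1%:R^-1.
  pose c : R := Num.min ((lj k).2.+1%:R^-1) ((lj k').2.+1%:R^-1) / 2.
  have [c0 cj cj'] : [/\ 0 < c, c < (lj k).2.+1%:R^-1 & c < (lj k').2.+1%:R^-1].
    by apply: half_min_lt; rewrite invr_gt0.
  have := good_at_real (v := fun j => if j == i then c else 0) lf (Hlj k).
  have := good_at_real (v := fun j => if j == i then c else 0) lf (Hlj k').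
  rewrite l1norm_delta !dot_prod_delta gtr0_norm// -/(a k i) -/(a k' i) => /(_ cj') H' /(_ cj) H.
  rewrite -(ler_pM2r c0) mulrDl -{1}(gtr0_norm c0) -normrM mulrBl.
  set F := f _ - f t in H H'.
  rewrite (_ : _ - _ = (F - a k' i * c) - (F - a k i * c)); last by ring.
  by rewrite [leRHS]addrC (le_trans (ler_normB _ _))// lerD.
have /choice[l Hl] : forall i : nat, exists l, (i < n)%N -> forall k, `|a k i - l| <= k.+1%:R^-1.
  move=> i; have [iltn|] := ltnP i n; last by exists 0.
  have [l Hl] := cauchy_bounds_limit (ca (Ordinal iltn)).
  by exists l.
exists l => e e0.
have [k ke] : exists k, (k.+1%:R^-1 : R) <= e / 2.
  exists (Num.bound (e / 2)^-1).
  have e20 : 0 < e / 2 by rewrite divr_gt0.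
  rewrite -[leRHS]invrK lef_pV2 ?posrE ?invr_gt0//.
  have : 0 <= (e / 2)^-1 by rewrite invr_ge0 ltW.
  by move=> /archi_boundP; rewrite -natr1; lra.
(* One index further than [good_at] gives, since [good_at_real] asks for a strict inequality. *)
exists ((lj k).2.+2%:R^-1); first by rewrite invr_gt0.
move=> v vj.
have vj' : l1norm n v < (lj k).2.+1%:R^-1.
  by apply: le_lt_trans vj _; rewrite ltf_pV2 ?posrE// ltr_nat.
have H := good_at_real lf (Hlj k) vj'.
have H2 : `|dot_prod n (a k) v - dot_prod n l v| <= k.+1%:R^-1 * l1norm n v.
  by rewrite dot_prodB; apply: ler_norm_dot_prod => i iltn; exact: Hl.
rewrite (_ : _ - _ = (f (eshift t v) - f t - dot_prod n (a k) v) +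
  (dot_prod n (a k) v - dot_prod n l v)); last by ring.
rewrite (le_trans (ler_normD _ _))// [e]splitr [leRHS]mulrDl lerD//.
  by apply: le_trans H _; rewrite ler_wpM2r// l1norm_ge0.
by apply: le_trans H2 _; rewrite ler_wpM2r// l1norm_ge0.
Qed.

(** * Finite-dimensional normed spaces *)

Section norm_equivalence.
Variables (R : realType) (X : finNormedModType R) (n : nat) (e : n.-tuple X).

Definition lin_comb (u : 'rV[R]_n) : X := \sum_(i < n) u 0 i *: e`_i.

Lemma lin_comb_continuous : continuous lin_comb.
Proof.
apply: continuous_big => [|i _ u]; first exact: add_continuous.
exact: (cvgZ (@coord_continuous R 1 n 0 i u) (cvg_cst _)).
Qed.

Lemma lin_combZ a u : lin_comb (a *: u) = a *: lin_comb u.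
Proof. by rewrite /lin_comb scaler_sumr; apply: eq_bigr => i _; rewrite mxE scalerA. Qed.

Hypothesis fe : free e.

Lemma lin_comb_eq0 u : lin_comb u = 0 -> u = 0.
Proof.
move=> u0; apply/rowP => i; rewrite mxE.
by move/freeP : fe => /(_ (fun i => u 0 i) u0).
Qed.

(** The norm of [lin_comb] attains its minimum on the compact unit sphere, and freeness makes this
    minimum positive. *)
Lemma lin_comb_norm_ge : exists2 m : R, 0 < m & forall u, m * `|u| <= `|lin_comb u|.
Proof.
pose S := [set u : 'rV[R]_n | `|u| = 1].
have [S0|/set0P S0] := eqVneq S set0.
  (* If the sphere is empty, 0 is the only vector and any positive constant works. *)
  exists 1 => // u; have [->|u0] := eqVneq u 0; first by rewrite normr0 mulr0.
  have : S (`|u|^-1 *: u) by rewrite /S/= normrZ normfV normr_id mulVf ?normr_eq0.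
  by rewrite S0.
have cS : compact S.
  apply: bounded_closed_compact.
    by exists 1; split => // x x1 u /= ->; exact: ltW.
  rewrite (_ : S = (fun u => `|u|) @^-1` [set 1]) //.
  apply: preimage_closed; last exact: closed_eq.
  by move=> u _; exact: norm_continuous.
have cE : {within S, continuous (fun u => `|lin_comb u|)}.
  apply: continuous_subspaceT => u.
  by apply: continuous_comp; [exact: lin_comb_continuous|exact: norm_continuous].
have [c cS1 Hc] := compact_EVT_min S0 cS cE.
have c1 : `|c| = 1 by move: cS1; rewrite inE.
exists `|lin_comb c|.
  rewrite normr_gt0; apply/eqP => /lin_comb_eq0 c0.
  by move: c1; rewrite c0 normr0 => /esym/eqP; rewrite oner_eq0.
move=> u; have [->|u0] := eqVneq u 0; first by rewrite normr0 mulr0.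
have nu0 : 0 < `|u| by rewrite normr_gt0.
have := Hc (`|u|^-1 *: u); rewrite inE /S/= normrZ normfV normr_id mulVf ?normr_eq0// => /(_ erefl).
by rewrite lin_combZ normrZ normfV normr_id ler_pdivlMl// mulrC.
Qed.

End norm_equivalence.

Lemma coord_bounded (R : realType) (X : finNormedModType R) (e : (\dim {:X}).-tuple X) :
  basis_of {:X} e -> exists2 c : R, 0 < c & forall i x, `|coord e i x| <= c * `|x|.
Proof.
move=> be; have [m m0 Hm] := lin_comb_norm_ge (basis_free be).
exists m^-1; first by rewrite invr_gt0.
move=> i x; rewrite ler_pdivlMl//.
have := Hm (\row_i coord e i x).
rewrite (_ : lin_comb _ _ = x); last first.
  rewrite [RHS](coord_basis be (memvf x)); apply: eq_bigr => j _.
  by rewrite mxE.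
apply: le_trans; rewrite ler_pM2l// [leRHS]/Num.norm /= mx_normrE.
apply: le_trans (le_bigmax _ (fun ij => `|(\row_i coord e i x) ij.1 ij.2|) (ord0, i)).
by rewrite /= mxE.
Qed.

(** [A] is a closed subset of the image under [lin_comb] of a closed ball of coordinate vectors,
    which is compact. *)
Lemma bounded_closed_compact_fin (R : realType) (X : finNormedModType R) (A : set X) (M : R) :
  closed A -> (forall x, A x -> `|x| <= M) -> compact A.
Proof.
move=> cA AM; have be := vbasisP {:X}.
have [m m0 Hm] := lin_comb_norm_ge (basis_free be).
pose B := [set u : 'rV[R]_(\dim {:X}) | `|u| <= M / m].
have cB : compact B.
  apply: bounded_closed_compact.
    exists (M / m); split => [|x x1 u /= /le_trans]; first exact: num_real.
    by apply; exact: ltW.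
  rewrite (_ : B = (fun u => `|u|) @^-1` [set x | x <= M / m]) //.
  apply: preimage_closed; last exact: closed_le.
  by move=> u _; exact: norm_continuous.
have cE := continuous_subspaceT (A := B) (@lin_comb_continuous _ _ _ (vbasis {:X})).
apply: (subclosed_compact cA (continuous_compact cE cB)).
move=> x Ax; pose u := \row_i coord (vbasis {:X}) i x.
have ux : lin_comb (vbasis {:X}) u = x.
  rewrite [RHS](coord_basis be (memvf x)); apply: eq_bigr => j _.
  by rewrite mxE.
exists u => //; rewrite /B/= ler_pdivlMr// mulrC.
by apply: le_trans (Hm _) _; rewrite ux; exact: AM.
Qed.

Lemma linear_bounded (R : realType) (X Y : finNormedModType R) (f : {linear X -> Y}) :
  exists2 c : R, 0 < c & forall x, `|f x| <= c * `|x|.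
Proof.
have be := vbasisP {:X}; have [c c0 Hc] := coord_bounded be.
pose M := \sum_(i < \dim {:X}) `|f (vbasis {:X})`_i|.
have M0 : 0 <= M by exact: sumr_ge0.
exists (c * M + 1); first by rewrite ltr_wpDl// mulr_ge0// ltW.
move=> x; rewrite mulrDl mul1r; apply: ler_wpDr => //.
rewrite {1}(coord_basis be (memvf x)) linear_sum.
apply: le_trans (ler_norm_sum _ _ _) _; rewrite mulrAC mulr_sumr.
by apply: ler_sum => i _; rewrite linearZ normrZ ler_wpM2r.
Qed.

Lemma bounded_linear_cont (R : realType) (X Y : normedModType R) (f : {linear X -> Y}) (c : R) :
  (forall x, `|f x| <= c * `|x|) -> continuous f.
Proof.
move=> fc; apply: bounded_linear_continuous.
exists `|c|; split => // M cM; near=> x; apply: le_trans (fc x) _.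
have x1 : `|x| <= 1 by near: x; exact: nbhs0_le.
apply: le_trans (ltW cM); apply: le_trans (ler_wpM2r _ (ler_norm c)) _ => //.
by rewrite -[leRHS]mulr1 ler_wpM2l.
Unshelve. all: by end_near. Qed.

Lemma differentiable_expansion (R : realType) (X Y : normedModType R) (f : X -> Y) x :
  differentiable f x -> forall e : R, 0 < e -> exists2 d : R, 0 < d &
    forall h, `|h| <= d -> `|f (x + h) - f x - 'd f x h| <= e * `|h|.
Proof.
move=> df e e0; have /eqaddoP/(_ e e0)/nbhs_ballP[d /= d0 H] := diff_locally df.
exists (d / 2); first by rewrite divr_gt0.
move=> h hd; have /= := H h; rewrite opprD addrA [x + h]addrC; apply.
rewrite -ball_normE /= sub0r normrN; apply: le_lt_trans hd _.
by rewrite ltr_pdivrMr//; lra.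
Qed.

Lemma expansion_differentiable (R : realType) (X Y : normedModType R) (f : X -> Y)
    (g : {linear X -> Y}) x :
  continuous g -> (forall e : R, 0 < e -> exists2 d : R, 0 < d &
    forall h, `|h| <= d -> `|f (x + h) - f x - g h| <= e * `|h|) ->
  differentiable f x.
Proof.
move=> cg fg.
have E : f \o shift x = cst (f x) + g +o_ 0 id.
  apply/eqaddoP => e e0; have [d d0 H] := fg e e0.
  apply/nbhs_ballP; exists d => //= h.
  rewrite -ball_normE /= sub0r normrN => /ltW /H.
  by rewrite opprD addrA [x + h]addrC.
by apply/diff_locallyP; rewrite (diff_unique cg E).
Qed.

(** The first-order condition at a minimum, used for projections and Rayleigh quotients. Restricting
    to [t < 1] lets [1 - t] serve as a positive factor in the cone. *)
Lemma quadratic_ge0 (R : realFieldType) (a b : R) :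
  (forall t : R, 0 < t -> t < 1 -> 0 <= a * t + b * t ^+ 2) -> 0 <= a.
Proof.
move=> H; rewrite leNgt; apply/negP => a0.
(* If [a < 0], the second bound gives |b| t <= - a / 2 - t, so that a + b t < 0. *)
pose t := Num.min (1 / 2) (- a / (2 * (`|b| + 1))).
have b1 : 0 < `|b| + 1 by rewrite ltr_wpDl.
have t0 : 0 < t by rewrite lt_min !divr_gt0 ?oppr_gt0// mulr_gt0.
have t1 : t < 1 by rewrite gt_min; apply/orP; left; lra.
have ta : t * (2 * (`|b| + 1)) <= - a.
  by rewrite -ler_pdivlMr ?mulr_gt0// ge_min lexx orbT.
have := H t t0 t1; rewrite expr2 mulrA -mulrDl pmulr_lge0//.
have bt : b * t <= `|b| * t by rewrite ler_wpM2r ?ler_norm// ltW.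
move: ta bt; rewrite (_ : t * _ = 2 * (`|b| * t) + 2 * t); [lra|ring].
Qed.

Lemma is_derive_quadratic (R : realType) (u : R -> R) (s a C : R) :
  (forall d, `|u (s + d) - u s - d * a| <= C * d ^+ 2) -> is_derive s (1 : R) u a.
Proof.
move=> H.
have L : h^-1 *: ((u \o shift s) (h *: (1 : R)) - u s) @[h --> 0^'] --> a.
  apply/cvgrPdist_le => e e0.
  have C0 : 0 < `|C| + 1 by rewrite ltr_wpDl.
  exists (e / (`|C| + 1)) => /=; first by rewrite divr_gt0.
  move=> h; rewrite /= sub0r normrN => he h0.
  rewrite [h *: 1]mulr1 [h + s]addrC.
  have := H h; set D := u (s + h) - u s => Hh.
  have -> : a - h^-1 *: D = - (h^-1 * (D - h * a)).
    by rewrite /GRing.scale/=; field.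
  rewrite normrN normrM normfV ler_pdivrMl ?normr_gt0//.
  apply: le_trans Hh _; rewrite -(real_normK (num_real h)) expr2 mulrA.
  rewrite [leRHS]mulrC ler_wpM2r//.
  move: he; rewrite ltr_pdivlMr// => he; apply: le_trans (ltW he).
  rewrite mulrC ler_wpM2l//; have := ler_norm C; lra.
split; first by apply/cvg_ex; exists a.
exact: cvg_lim L.
Qed.

(** Passage to the limit for limiting Jacobians: each property is written as [a <= 0], with [a]
    bounded by a vanishing error. *)
Lemma le0_of_cvg (R : realType) (a : R) (w : nat -> R) :
  w k @[k --> \oo] --> (0 : R) -> (forall k, a <= w k) -> a <= 0.
Proof.
move=> w0 aw; rewrite leNgt; apply/negP => a0.
have /cvgrPdist_lt/(_ a a0)[N _ H] := w0.
have := H N (leqnn N); rewrite sub0r normrN ltNge.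
by rewrite (le_trans (aw N) (ler_norm _)).
Qed.

(** * Operator norm and eigenvalues *)

Lemma opnorm_has_ubound (R : realType) (X : finNormedModType R) (T : 'End(X)) :
  has_ubound [set `|T x| | x in [set x : X | `|x| = 1]].
Proof.
have [c c0 Hc] := linear_bounded T.
by exists c => _ [x /= x1 <-]; rewrite (le_trans (Hc x))// x1 mulr1.
Qed.

Lemma opnorm_ub (R : realType) (X : finNormedModType R) (T : 'End(X)) x : `|T x| <= opnorm T * `|x|.
Proof.
have [->|x0] := eqVneq x 0; first by rewrite linear0 !normr0 mulr0.
have nx : 0 < `|x| by rewrite normr_gt0.
have -> : `|T x| = `|T (`|x|^-1 *: x)| * `|x|.
  by rewrite linearZ normrZ normfV normr_id mulrC mulVKf// gt_eqF.
rewrite ler_wpM2r//; apply: ub_le_sup; first exact: opnorm_has_ubound.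
by exists (`|x|^-1 *: x) => //=; rewrite normrZ normfV normr_id mulVf// gt_eqF.
Qed.

Lemma opnorm_le (R : realType) (X : finNormedModType R) (T : 'End(X)) (c : R) :
  0 <= c -> (forall x, `|T x| <= c * `|x|) ->
  opnorm T <= c.
Proof.
move=> c0 Tc; rewrite /opnorm.
set S := [set _ | _ in _]; have [->|/set0P S0] := eqVneq S set0; first by rewrite sup0.
by apply: ge_sup => // _ [x /= x1 <-]; rewrite (le_trans (Tc x))// x1 mulr1.
Qed.

Lemma leigenvalueP (R : realType) (X : finNormedModType R) (T : 'End(X)) (b : R) :
  passmx.leigenvalue T b <-> exists2 v : X, v != 0 & T v = b *: v.
Proof.
rewrite /passmx.leigenvalue /passmx.leigenspace.
have memE v : (v \in lker (T - b *: \1%VF)) = (T v == b *: v).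
  by rewrite memv_ker add_lfunE opp_lfunE scale_lfunE id_lfunE subr_eq0.
split => [n0|[v v0 Tv]].
  exists (vpick (lker (T - b *: \1%VF))); first by rewrite vpick0.
  by apply/eqP; rewrite -memE memv_pick.
by apply/negP => /eqP E; move: (memE v); rewrite E memv0 Tv eqxx (negbTE v0).
Qed.

(** * Projection onto a closed convex cone *)

Section inner_product.
Variables (R : realType) (X : finNormedModType R) (ip : {dot X for (idfun : R -> R)}).
Hypothesis ip_norm : norm_of_dot ip.
Implicit Types (x y z : X) (a : R).

Lemma ipC x y : ip x y = ip y x.
Proof. by have := hermC ip x y; rewrite expr0 mul1r. Qed.

Lemma ipDl x y z : ip (x + y) z = ip x z + ip y z.
Proof. exact: linearDl. Qed.

Lemma ipZl a x z : ip (a *: x) z = a * ip x z.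
Proof. exact: linearZl_LR. Qed.

Lemma ipDr x y z : ip z (x + y) = ip z x + ip z y.
Proof. by rewrite ipC ipDl !(ipC z). Qed.

Lemma ipZr a x z : ip z (a *: x) = a * ip z x.
Proof. by rewrite ipC ipZl (ipC z). Qed.

Lemma ipNl x z : ip (- x) z = - ip x z.
Proof. by rewrite -scaleN1r ipZl mulN1r. Qed.

Lemma ipNr x z : ip z (- x) = - ip z x.
Proof. by rewrite ipC ipNl (ipC z). Qed.

Lemma ipBl x y z : ip (x - y) z = ip x z - ip y z.
Proof. by rewrite ipDl ipNl. Qed.

Lemma ipBr x y z : ip z (x - y) = ip z x - ip z y.
Proof. by rewrite ipDr ipNr. Qed.

Lemma ip0l x : ip 0 x = 0.
Proof. by rewrite -(scale0r x) ipZl mul0r. Qed.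

Lemma ip_sumr n (f : 'I_n -> X) x : ip x (\sum_i f i) = \sum_i ip x (f i).
Proof. exact: linear_sumr. Qed.

Lemma ip_suml n (f : 'I_n -> X) x : ip (\sum_i f i) x = \sum_i ip (f i) x.
Proof. by rewrite ipC ip_sumr; apply: eq_bigr => i _; exact: ipC. Qed.

Lemma ip_sqr x : ip x x = `|x| ^+ 2.
Proof.
rewrite ip_norm sqr_sqrtr//; have [->|x0] := eqVneq x 0; first by rewrite ip0l.
exact/ltW/neq0_dnorm_gt0.
Qed.

(** Square the triangle inequality, which the norm of [X] already satisfies, and cancel the
    squares. *)
Lemma cauchy_schwarz x y : `|ip x y| <= `|x| * `|y|.
Proof.
have H z w : ip z w <= `|z| * `|w|.
  have : `|z + w| ^+ 2 <= (`|z| + `|w|) ^+ 2.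
    by rewrite ler_sqr ?nnegrE ?addr_ge0// ler_normD.
  rewrite -ip_sqr ipDl !ipDr !ip_sqr (ipC w z) sqrrD; lra.
by rewrite ler_norml H andbT lerNl -ipNl -(normrN x).
Qed.

Lemma ip_eq x y : (forall z, ip x z = ip y z) -> x = y.
Proof.
move=> xy; apply/eqP; rewrite -subr_eq0 -normr_eq0 -sqrf_eq0 -ip_sqr ipBl.
by rewrite xy subrr.
Qed.

Variable K : set X.
Hypotheses (K_nonempty : K !=set0) (K_closed : closed K) (K_cone : convex_cone K).

Lemma cone_scale t x : 0 < t -> K x -> K (t *: x).
Proof. exact: K_cone.2. Qed.

(** The sum is twice the midpoint. *)
Lemma cone_add x y : K x -> K y -> K (x + y).
Proof.
move=> Kx Ky.
have h0 : 0 <= (2^-1 : R) by [].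
have h1 : (2^-1 : R) <= 1 by lra.
have := K_cone.1 x y (Itv01 h0 h1); rewrite !inE => /(_ Kx Ky) Kxy.
have {}Kxy : K (2^-1 *: x + (1 - 2^-1) *: y) by [].
have := cone_scale (ltr0n R 2) Kxy.
rewrite scalerDr !scalerA (_ : 2 * 2^-1 = 1); last by field.
by rewrite (_ : 2 * (1 - 2^-1) = 1) ?scale1r//; field.
Qed.

Lemma argmin_exists x : exists p, argmin_on (fun y => `|y - x|) K p.
Proof.
have [k Kk] := K_nonempty.
have cf : continuous (fun y => `|y - x|).
  move=> u; apply: (@continuous_comp _ _ _ (fun y => y - x) (fun y => `|y|)).
    by apply: cvgB; [exact: cvg_id|exact: cvg_cst].
  exact: norm_continuous.
(* Only points at least as close to x as [k] compete, and they form a compact set. *)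
pose A := K `&` [set y | `|y - x| <= `|k - x|].
have cA : compact A.
  apply: (@bounded_closed_compact_fin _ _ _ (`|k - x| + `|x|)).
    apply: closedI => //.
    rewrite (_ : [set _ | _] = (fun y => `|y - x|) @^-1` [set r | r <= `|k - x|]) //.
    apply: preimage_closed; last exact: closed_le.
    by move=> u _; exact: cf.
  move=> y [_ /= yk]; rewrite -{1}(subrK x y).
  by rewrite (le_trans (ler_normD _ _))// lerD2r.
have A0 : A !=set0 by exists k; split => /=.
have [p pA Hp] := compact_EVT_min A0 cA (continuous_subspaceT cf).
move: pA; rewrite inE => -[Kp pk]; exists p; split => // y Ky.
have [yk|ky] := leP `|y - x| `|k - x|; first by apply: Hp; rewrite inE.
by apply: le_trans pk _; exact: ltW.
Qed.

Local Notation P := (metric_proj K).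

Lemma metric_projP x : argmin_on (fun y => `|y - x|) K (P x).
Proof. by have [p Hp] := argmin_exists x; exact: (getI Hp). Qed.

Lemma proj_mem x : K (P x).
Proof. exact: (metric_projP x).1. Qed.

Lemma proj_min x y : K y -> `|P x - x| ^+ 2 <= `|y - x| ^+ 2.
Proof. by move=> Ky; rewrite ler_sqr ?nnegrE// (metric_projP x).2. Qed.

(** Compare [P x] with the points P x + t y of the cone and keep the first-order term in t. *)
Lemma proj_polar x y : K y -> ip (x - P x) y <= 0.
Proof.
move=> Ky; suff : 0 <= - (2 * ip (x - P x) y) by lra.
apply: (@quadratic_ge0 _ _ (ip y y)) => t t0 _.
have := proj_min x (cone_add (proj_mem x) (cone_scale t0 Ky)).
rewrite -!ip_sqr !(ipDl, ipDr, ipNl, ipNr, ipZl, ipZr) (ipC y x) (ipC y (P x)) (ipC (P x) x).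
by rewrite expr2; lra.
Qed.

(** One inequality is [proj_polar] at [P x]; the other compares [P x] with (1 - t) P x. *)
Lemma proj_orth x : ip (x - P x) (P x) = 0.
Proof.
apply/eqP; rewrite eq_le proj_polar/=; last exact: proj_mem.
suff : 0 <= 2 * ip (x - P x) (P x) by lra.
apply: (@quadratic_ge0 _ _ (ip (P x) (P x))) => t t0 t1.
have t1' : 0 < 1 - t by lra.
have := proj_min x (cone_scale t1' (proj_mem x)).
rewrite -!ip_sqr !(ipDl, ipDr, ipNl, ipNr, ipZl, ipZr) (ipC (P x) x).
by rewrite expr2; lra.
Qed.

(** The squared distance between [q] and [P x] expands into <x - P x, q> + <x - q, P x> minus two
    terms that vanish by orthogonality, and both remaining terms are nonpositive. *)
Lemma proj_unique x q : K q -> (forall y, K y -> ip (x - q) y <= 0) ->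
  ip (x - q) q = 0 -> q = P x.
Proof.
move=> Kq Hq oq; apply/eqP; rewrite -subr_eq0 -normr_eq0 -sqrf_eq0 -ip_sqr.
have := Hq _ (proj_mem x); have := proj_polar x Kq; have := proj_orth x.
move: oq; rewrite eq_le ip_sqr sqr_ge0 andbT -ip_sqr.
rewrite !(ipDl, ipDr, ipNl, ipNr) (ipC (P x) q); lra.
Qed.

Lemma proj_scale t x : 0 < t -> P (t *: x) = t *: P x.
Proof.
move=> t0; apply/esym/proj_unique; first exact/cone_scale/proj_mem.
  move=> y Ky; rewrite -scalerBr ipZl pmulr_rle0//; exact: proj_polar.
by rewrite -scalerBr ipZl ipZr proj_orth !mulr0.
Qed.

(** By orthogonality, the right-hand side minus the left-hand side is - <x - P x, P y> - <y - P y, P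
    x>. *)
Lemma proj_firmly_nonexpansive x y : `|P x - P y| ^+ 2 <= ip (P x - P y) (x - y).
Proof.
have := proj_orth x; have := proj_orth y.
have := proj_polar x (proj_mem y); have := proj_polar y (proj_mem x).
rewrite -ip_sqr !(ipDl, ipDr, ipNl, ipNr) (ipC (P x) x) (ipC (P y) y).
rewrite (ipC (P y) (P x)) (ipC (P x) y) (ipC (P y) x); lra.
Qed.

Lemma proj_nonexpansive x y : `|P x - P y| <= `|x - y|.
Proof.
have H := le_trans (proj_firmly_nonexpansive x y) (le_trans (ler_norm _) (cauchy_schwarz _ _)).
have [->|n0] := eqVneq `|P x - P y| 0; first exact: normr_ge0.
have n1 : 0 < `|P x - P y| by rewrite lt_def n0 normr_ge0.
by move: H; rewrite expr2 ler_pM2l.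
Qed.

(** Half the squared distance to the polar cone of [K], that is the Moreau envelope of the indicator
    of that cone; its gradient is [P]. *)
Definition moreau x : R := ip (P x) (P x) / 2.

(** The expression equals |P y - P x|^2 / 2 - <y - P y, P x>. *)
Lemma moreau_ge x y : 0 <= moreau y - moreau x - ip (P x) (y - x).
Proof.
have := proj_orth x; have := proj_polar y (proj_mem x).
have : 0 <= ip (P y - P x) (P y - P x) by rewrite ip_sqr sqr_ge0.
rewrite /moreau !(ipDl, ipDr, ipNl, ipNr) (ipC (P x) x) (ipC (P y) (P x)) (ipC (P x) y); lra.
Qed.

(** The remainders from x to y and from y to x add up to <P y - P x, y - x>, and the second one is
    nonnegative. *)
Lemma moreau_le x y : moreau y - moreau x - ip (P x) (y - x) <= `|y - x| ^+ 2.
Proof.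
have H := moreau_ge y x.
have : ip (P y - P x) (y - x) <= `|y - x| ^+ 2.
  apply: le_trans (ler_norm _) (le_trans (cauchy_schwarz _ _) _).
  by rewrite expr2 ler_wpM2r// proj_nonexpansive.
move: H; rewrite !(ipDl, ipDr, ipNl, ipNr); lra.
Qed.

(** * Symmetry of the derivative of a gradient map *)

Section derivative_symmetric.
Variables (g : X -> X) (phi : X -> R) (A : {linear X -> X}) (x : X).
Hypothesis phi_ge : forall y z, 0 <= phi z - phi y - ip (g y) (z - y).
Hypothesis phi_le : forall y z, phi z - phi y - ip (g y) (z - y) <= `|z - y| ^+ 2.
Hypothesis gA : forall e : R, 0 < e -> exists2 d : R, 0 < d &
  forall h, `|h| <= d -> `|g (x + h) - g x - A h| <= e * `|h|.

Lemma potential_derive z k s :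
  is_derive s (1 : R) (fun s : R => phi (z + s *: k)) (ip (g (z + s *: k)) k).
Proof.
apply: (@is_derive_quadratic _ _ _ _ (`|k| ^+ 2)) => d.
have E : z + (s + d) *: k - (z + s *: k) = d *: k.
  by rewrite scalerDl addrA [_ + d *: k]addrC addrK.
have := phi_ge (z + s *: k) (z + (s + d) *: k).
have := phi_le (z + s *: k) (z + (s + d) *: k).
rewrite E ipZr normrZ exprMn real_normK ?num_real// => h1 h2.
by rewrite ger0_norm// [leRHS]mulrC.
Qed.

(** As in the proof of Schwarz's theorem, the mean value theorem in s turns the second difference
    into an increment of [g], which is expanded at [x] only; no differentiability of [g] elsewhere
    enters. *)
Lemma second_difference h k (e : R) : 0 < e -> exists2 d : R, 0 < d &
  forall t : R, 0 < t -> t <= d ->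
  `|phi (x + t *: h + t *: k) - phi (x + t *: h) - phi (x + t *: k) + phi x
     - t ^+ 2 * ip (A h) k| <= t ^+ 2 * e.
Proof.
move=> e0.
(* Two expansions cost (e / c) t N each, and pairing with t k gives t^2 e (2 N |k| / c); the [+ 1]
   keeps [c] positive. *)
pose N := `|h| + `|k|; pose c := 2 * N * `|k| + 1.
have N0 : 0 <= N by rewrite addr_ge0.
have c0 : 0 < c by rewrite ltr_wpDl// !mulr_ge0.
have [d d0 Hd] := gA (divr_gt0 e0 c0).
exists (d / (N + 1)); first by rewrite divr_gt0// ltr_wpDl.
move=> t t0 td.
pose S s := phi (x + t *: h + s *: k) - phi (x + s *: k).
pose dS s := ip (g (x + t *: h + s *: k)) k - ip (g (x + s *: k)) k.
have dS1 s : is_derive s (1 : R) S (dS s).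
  by apply: is_deriveB; exact: potential_derive.
have [tau taut E] : exists2 tau, tau \in `]0, t[ & S t - S 0 = dS tau * (t - 0).
  apply: MVT => //.
  apply: derivable_within_continuous => s _.
  by have [] := dS1 s.
have -> : phi (x + t *: h + t *: k) - phi (x + t *: h) - phi (x + t *: k) + phi x = dS tau * t.
  by rewrite -[t in RHS]subr0 -E /S !scale0r !addr0; ring.
move: taut; rewrite in_itv/= => /andP[tau0 taut].
have nb a : 0 <= a -> a <= t -> `|a *: k| <= t * `|k|.
  by move=> a0 at'; rewrite normrZ ger0_norm// ler_wpM2r.
have dN : t * N <= d.
  apply: le_trans (_ : t * (N + 1) <= _); first by rewrite ler_wpM2l ?ltW//; lra.
  by rewrite -ler_pdivlMr// ltr_wpDl.
have n1 : `|t *: h + tau *: k| <= t * N.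
  rewrite (le_trans (ler_normD _ _))// /N mulrDr; apply: lerD.
    by rewrite normrZ gtr0_norm.
  by apply: nb; exact: ltW.
have n2 : `|tau *: k| <= t * N.
  rewrite (le_trans (nb _ (ltW tau0) (ltW taut)))// /N mulrDr lerDr.
  by rewrite mulr_ge0// ltW.
have H1 := Hd _ (le_trans n1 dN); have H2 := Hd _ (le_trans n2 dN).
have G : `|g (x + t *: h + tau *: k) - g (x + tau *: k) - t *: A h| <= 2 * (e / c) * (t * N).
  have -> : g (x + t *: h + tau *: k) - g (x + tau *: k) - t *: A h =
     (g (x + (t *: h + tau *: k)) - g x - A (t *: h + tau *: k)) -
     (g (x + tau *: k) - g x - A (tau *: k)).
    have -> : A (t *: h + tau *: k) = t *: A h + A (tau *: k).
      by rewrite linearD linearZ.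
    rewrite [x + (_ + _)]addrA.
    move: (g _) (g (x + tau *: k)) (A (tau *: k)) (t *: A h) => a b q p.
    by rewrite opprB addrA opprD addrA subrK opprB addrA [a - g x - p]addrAC subrK addrAC.
  rewrite (le_trans (ler_normB _ _))// -mulrA mulr_natl mulr2n lerD//.
    by apply: le_trans H1 _; rewrite ler_wpM2l// ltW// divr_gt0.
  by apply: le_trans H2 _; rewrite ler_wpM2l// ltW// divr_gt0.
have -> : dS tau * t - t ^+ 2 * ip (A h) k =
   t * ip (g (x + t *: h + tau *: k) - g (x + tau *: k) - t *: A h) k.
  by rewrite /dS !(ipBl, ipZl); ring.
rewrite normrM gtr0_norm// [t ^+ 2]expr2 -mulrA; apply: ler_wpM2l; first exact: ltW.
apply: le_trans (cauchy_schwarz _ _) _.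
apply: le_trans (ler_wpM2r _ G) _ => //.
rewrite [leLHS](_ : _ = t * (e * (2 * N * `|k| / c))); last by ring.
apply: ler_wpM2l; first exact: ltW.
by rewrite ger_pMr// ler_pdivrMr// mul1r /c lerDl.
Qed.

(** The second difference is symmetric in [h] and [k], and divided by t^2 it approximates both
    sides. *)
Lemma derivative_self_adjoint h k : ip (A h) k = ip (A k) h.
Proof.
apply/eqP; rewrite -subr_eq0 -normr_le0; apply/ler_addgt0Pr => e e0.
have e2 : 0 < e / 2 by rewrite divr_gt0.
have [d1 d10 H1] := second_difference h k e2.
have [d2 d20 H2] := second_difference k h e2.
pose t := Num.min d1 d2.
have t0 : 0 < t by rewrite lt_min d10.
have := H1 t t0; rewrite ge_min lexx => /(_ isT) {}H1.
have := H2 t t0; rewrite ge_min lexx orbT => /(_ isT) {}H2.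
move: H2; rewrite [x + t *: k + t *: h]addrAC => H2.
have t20 : 0 < t ^+ 2 by rewrite exprn_gt0.
rewrite add0r -(ler_pM2l t20) -{1}(gtr0_norm t20) -normrM mulrBr.
move: H1 H2; set D := phi (x + t *: h + t *: k); set a := phi _; set b := phi _.
set c := phi x; set u := t ^+ 2 * ip (A h) k; set v := t ^+ 2 * ip (A k) h => H1 H2.
have -> : u - v = (D - b - a + c - v) - (D - a - b + c - u) by ring.
rewrite (le_trans (ler_normB _ _))//.
by apply: le_trans (lerD H2 H1) _; rewrite -mulrDr -splitr.
Qed.

End derivative_symmetric.

(** One positive step per tolerance suffices to derive positivity, the norm bound and the value at
    [x]. *)
Lemma proj_diff_direction x h (e : R) : diff_points P x -> 0 < e -> exists2 t : R, 0 < t &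
  `|P (x + t *: h) - P x - t *: fderiv P x h| <= e * t.
Proof.
move=> dx e0; have h1 : 0 < `|h| + 1 by rewrite ltr_wpDl.
have [d d0 H] := differentiable_expansion dx (divr_gt0 e0 h1).
pose t := d / (`|h| + 1).
have t0 : 0 < t by rewrite divr_gt0.
exists t => //; have := H (t *: h).
have -> : 'd P x (t *: h) = t *: fderiv P x h by rewrite linearZ /fderiv lfunE.
rewrite normrZ gtr0_norm// => /(_ _)/le_trans; apply.
  by rewrite /t mulrAC ler_pdivrMr// ler_wpM2l ?ltW//; lra.
rewrite [leLHS](_ : _ = e * t * (`|h| / (`|h| + 1))); last by ring.
by rewrite ler_piMr ?mulr_ge0 ?ltW// ltr_pdivrMr//; lra.
Qed.

(** Gathers properties stable under limits and convex combinations, with the norm bound in pointwise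
    form, so that they pass from derivatives to limiting and then to Clarke Jacobians. *)
Definition jacobian_spec x (V : 'End(X)) :=
  [/\ self_adjoint ip V, forall y, 0 <= ip (V y) y, forall y, `|V y| <= `|y| & V x = P x].

Lemma fderiv_proj_spec x : diff_points P x -> jacobian_spec x (fderiv P x).
Proof.
move=> dx; split.
- move=> h k; rewrite (ipC h) /fderiv !lfunE.
  apply: (derivative_self_adjoint moreau_ge moreau_le) => e e0.
  exact: (differentiable_expansion dx).
- move=> h; apply/ler_addgt0Pr => e e0; rewrite -lerBlDr sub0r.
  have h1 : 0 < `|h| + 1 by rewrite ltr_wpDl.
  have [t t0 Ht] := proj_diff_direction h dx (divr_gt0 e0 h1).
  set D := P (x + t *: h) - P x in Ht.
  have D0 : 0 <= ip D h.
    rewrite -(pmulr_rge0 _ t0) -ipZr.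
    have := proj_firmly_nonexpansive (x + t *: h) x.
    have -> : x + t *: h - x = t *: h by rewrite addrC addKr.
    by apply: le_trans; exact: sqr_ge0.
  have : ip (D - t *: fderiv P x h) h <= e * t.
    apply: le_trans (ler_norm _) (le_trans (cauchy_schwarz _ _) _).
    apply: le_trans (ler_wpM2r (normr_ge0 _) Ht) _.
    rewrite [leLHS](_ : _ = e * t * (`|h| / (`|h| + 1))); last by ring.
    by rewrite ler_piMr ?mulr_ge0 ?ltW// ltr_pdivrMr//; lra.
  rewrite ipBl ipZl => H; rewrite -(ler_pM2l t0).
  lra.
- move=> h; apply/ler_addgt0Pr => e e0.
  have [t t0 Ht] := proj_diff_direction h dx e0.
  rewrite -(ler_pM2l t0) -{1}(gtr0_norm t0) -normrZ mulrDr.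
  rewrite -(subrK (P (x + t *: h) - P x) (t *: _)).
  rewrite (le_trans (ler_normD _ _))// addrC lerD//.
    apply: le_trans (proj_nonexpansive _ _) _.
    by rewrite [x + _]addrC addrK normrZ gtr0_norm.
  by rewrite distrC [t * e]mulrC.
- apply/eqP; rewrite -subr_eq0 -normr_le0; apply/ler_addgt0Pr => e e0.
  have [t t0 Ht] := proj_diff_direction x dx e0.
  (* In the direction [x] itself, positive homogeneity makes the increment exactly linear. *)
  have E : P (x + t *: x) - P x = t *: P x.
    rewrite -{1}(scale1r x) -scalerDl proj_scale ?addr_gt0//.
    by rewrite scalerDl scale1r addrC addKr.
  rewrite add0r distrC -(ler_pM2l t0) -{1}(gtr0_norm t0) -normrZ scalerBr.
  by rewrite E [e * t]mulrC in Ht.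
Qed.

Lemma limiting_jacobian_spec x L : limiting_jacobians P x L -> jacobian_spec x L.
Proof.
move=> [u [ux du uL]].
pose v k := opnorm (fderiv P (u k) - L).
have vub k y : `|fderiv P (u k) y - L y| <= v k * `|y|.
  by have := opnorm_ub (fderiv P (u k) - L) y; rewrite add_lfunE opp_lfunE.
have spec k := fderiv_proj_spec (du k).
have vc (c : R) : v k * c @[k --> \oo] --> (0 : R).
  by rewrite -(mul0r c); apply: cvgMl.
split.
- move=> y z; apply/eqP; rewrite -subr_eq0 -normr_le0.
  apply: (le0_of_cvg (vc (2 * `|y| * `|z|))) => k; have [sa _ _ _] := spec k.
  have -> : ip (L y) z - ip y (L z) =
    ip y (fderiv P (u k) z - L z) - ip (fderiv P (u k) y - L y) z.
    by rewrite ipBr ipBl sa; ring.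
  rewrite (le_trans (ler_normB _ _))//.
  apply: le_trans (lerD (cauchy_schwarz _ _) (cauchy_schwarz _ _)) _.
  apply: le_trans (lerD (ler_wpM2l (normr_ge0 _) (vub k z)) (ler_wpM2r (normr_ge0 _) (vub k y))) _.
  by rewrite le_eqVlt; apply/orP; left; apply/eqP; ring.
- move=> y; rewrite -oppr_le0; apply: (le0_of_cvg (vc (`|y| * `|y|))) => k.
  have [_ ps _ _] := spec k.
  have -> : - ip (L y) y = ip (fderiv P (u k) y - L y) y - ip (fderiv P (u k) y) y.
    by rewrite ipBl; ring.
  rewrite lerBlDr ler_wpDr//.
  apply: le_trans (ler_norm _) (le_trans (cauchy_schwarz _ _) _).
  by rewrite mulrA ler_wpM2r.
- move=> y; rewrite -subr_le0; apply: (le0_of_cvg (vc `|y|)) => k.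
  have [_ _ nx _] := spec k.
  rewrite lerBlDr -(subrK (fderiv P (u k) y) (L y)).
  by rewrite (le_trans (ler_normD _ _))// lerD// distrC.
- apply/eqP; rewrite -subr_eq0 -normr_le0.
  (* The base point moves too: |u k - x| is paid once for the derivative at [u k] and once for [P],
     both nonexpansive. *)
  have uc : v k * `|x| + `|u k - x| * 2 @[k --> \oo] --> (0 : R).
    rewrite -[X in _ --> X]addr0; apply: cvgD; first exact: vc.
    rewrite -(mul0r (2 : R)); apply: cvgMl.
    by apply/norm_cvg0P/subr_cvg0.
  apply: (le0_of_cvg uc) => k; have [_ _ nx Ak] := spec k.
  have -> : L x - P x = - (fderiv P (u k) x - L x) - fderiv P (u k) (u k - x) + (P (u k) - P x).
    have -> : fderiv P (u k) (u k - x) = P (u k) - fderiv P (u k) x.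
      by rewrite -Ak; exact: linearB.
    by rewrite !opprB !addrA !subrK.
  rewrite (le_trans (ler_normD _ _))// mulr_natr mulr2n addrA lerD//; last exact: proj_nonexpansive.
  by rewrite (le_trans (ler_normB _ _))// normrN lerD.
Qed.

Lemma clarke_jacobian_spec x V : clarke_jacobian P x V -> jacobian_spec x V.
Proof.
move=> [m [c [a [c0 c1 Ha ->]]]].
have spec i := limiting_jacobian_spec (Ha i).
have E y : (\sum_i c i *: a i) y = \sum_i c i *: a i y.
  by rewrite sum_lfunE; apply: eq_bigr => i _; rewrite scale_lfunE.
split.
- move=> y z; rewrite !E ip_suml ip_sumr; apply: eq_bigr => i _.
  by rewrite ipZl ipZr; have [-> _ _ _] := spec i.
- move=> y; rewrite E ip_suml; apply: sumr_ge0 => i _.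
  by rewrite ipZl mulr_ge0//; have [_ ? _ _] := spec i.
- move=> y; rewrite E (le_trans (ler_norm_sum _ _ _))//.
  rewrite -[leRHS]mul1r -c1 mulr_suml; apply: ler_sum => i _.
  by rewrite normrZ ger0_norm// ler_wpM2l//; have [_ _ ? _] := spec i.
- rewrite E -[RHS]scale1r -c1 scaler_suml; apply: eq_bigr => i _.
  by have [_ _ _ ->] := spec i.
Qed.

(** A maximizer of <T x, x> on the compact unit sphere is an eigenvector, and the maximum bounds
    every eigenvalue. *)
Lemma rayleigh_max (T : 'End(X)) : self_adjoint ip T -> (0 < \dim {:X})%N ->
  exists lmax : R, is_lambda_max T lmax.
Proof.
move=> sa d0; pose S := [set x : X | `|x| = 1].
have cS : compact S.
  apply: (@bounded_closed_compact_fin _ _ _ 1); last by move=> x /= ->.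
  rewrite (_ : S = (fun u => `|u|) @^-1` [set 1]) //.
  apply: preimage_closed; last exact: closed_eq.
  by move=> u _; exact: norm_continuous.
have S0 : S !=set0.
  pose v := vpick {:X}; have v0 : v != 0.
    by rewrite vpick0 -dimv_eq0 -lt0n.
  by exists (`|v|^-1 *: v); rewrite /S/= normrZ normfV normr_id mulVf// normr_eq0.
have T0 : T 0 = 0 by exact: linear0.
have TZ a x : T (a *: x) = a *: T x by exact: linearZ.
have TD x y : T (x + y) = T x + T y by exact: linearD.
have [c c0 Hc] := linear_bounded T.
have cT : continuous T by exact: bounded_linear_cont Hc.
have cn (g : X -> X) : continuous g -> continuous (fun x => `|g x| ^+ 2).
  by move=> cg x; rewrite /continuous_at expr2; apply: cvgM; apply: cvg_norm; exact: cg.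
have cf : continuous (fun x => ip (T x) x).
  (* Polarization reduces the continuity of the quadratic form to that of the norm. *)
  have -> : (fun x => ip (T x) x) =
      (fun x => (`|T x + x| ^+ 2 - `|T x - x| ^+ 2) * 4^-1).
    apply/funext => x; rewrite -!ip_sqr !(ipDl, ipDr, ipNl, ipNr) (ipC x (T x)).
    by field.
  move=> x; apply: cvgM; last exact: cvg_cst.
  apply: cvgB; [apply: (cn (fun y => T y + y)) => y|apply: (cn (fun y => T y - y)) => y].
    by apply: cvgD; [exact: cT|exact: cvg_id].
  by apply: cvgB; [exact: cT|exact: cvg_id].
have [v vS Hv] := compact_EVT_max S0 cS (continuous_subspaceT cf).
have v1 : `|v| = 1 by move: vS; rewrite inE.
pose l := ip (T v) v.
have ray x : ip (T x) x <= l * `|x| ^+ 2.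
  have [->|x0] := eqVneq x 0; first by rewrite T0 ip0l normr0 expr0n mulr0.
  have nx : 0 < `|x| by rewrite normr_gt0.
  have := Hv (`|x|^-1 *: x); rewrite inE /S/= normrZ normfV normr_id mulVf ?gt_eqF// => /(_ erefl).
  rewrite TZ ipZl ipZr mulrA -invfM -expr2 ler_pdivrMl ?exprn_gt0//.
  by rewrite mulrC.
have ev : T v = l *: v.
  apply: ip_eq => w; rewrite ipZl.
  (* The form l |x|^2 - <T x, x> is nonnegative and vanishes at [v], so its first-order term there
     is nonnegative in every direction; using [w] and [- w] makes it zero. *)
  have H z : 0 <= 2 * (l * ip v z - ip (T v) z).
    apply: (@quadratic_ge0 _ _ (l * ip z z - ip (T z) z)) => t _ _.
    have := ray (v + t *: z).
    rewrite -ip_sqr TD TZ !(ipDl, ipDr, ipZl, ipZr) (sa z v) (ipC z v) (ipC z (T v)).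
    rewrite ip_sqr v1 expr1n -/l expr2; lra.
  apply/eqP; rewrite eq_le; apply/andP; split.
    by have := H w; lra.
  by have := H (- w); rewrite !ipNr; lra.
exists l; split.
  by apply/leigenvalueP; exists v => //; rewrite -normr_gt0 v1.
move=> b /leigenvalueP[w w0 Tw].
have := ray w; rewrite Tw ipZl ip_sqr ler_pM2r//.
by rewrite exprn_gt0// normr_gt0.
Qed.

Lemma rayleigh_min (T : 'End(X)) : self_adjoint ip T -> (0 < \dim {:X})%N ->
  exists lmin : R, is_lambda_min T lmin.
Proof.
move=> sa d0; have saN : self_adjoint ip (- T).
  by move=> x y; rewrite !opp_lfunE ipNl ipNr sa.
have eN b : passmx.leigenvalue T b -> passmx.leigenvalue (- T) (- b).
  move=> /leigenvalueP[w w0 Tw]; apply/leigenvalueP; exists w => //.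
  by rewrite opp_lfunE Tw scaleNr.
have [l [/leigenvalueP[w w0 Tw] lmax]] := rayleigh_max saN d0.
exists (- l); split.
  apply/leigenvalueP; exists w => //.
  by rewrite scaleNr -Tw opp_lfunE opprK.
by move=> b /eN /lmax; rewrite lerNl.
Qed.

End inner_product.

(** * Almost everywhere differentiability of nonexpansive maps *)

Section coordinates.
Variables (R : realType) (X : finNormedModType R) (e : (\dim {:X}).-tuple X).
Hypothesis be : basis_of {:X} e.
Local Notation n := (\dim {:X}).

Definition eucl_point (t : eucl R n) : X := \sum_(i < n) eucl_nth t i *: e`_i.

(** Padding with 0 turns the coordinates of [h] into an increment for [eshift]. *)
Definition coord_nat (h : X) (j : nat) : R := if insub j is Some i then coord e i h else 0.

Lemma coord_natE h (i : 'I_n) : coord_nat h i = coord e i h.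
Proof. by rewrite /coord_nat valK. Qed.

Lemma eucl_point_shift t h : eucl_point (eshift t (coord_nat h)) = eucl_point t + h.
Proof.
rewrite {2}(coord_basis be (memvf h)) /eucl_point -big_split/=.
apply: eq_bigr => i _; rewrite eucl_nth_of ?ltn_ord//.
by rewrite coord_natE scalerDl.
Qed.

Lemma differentiable_eucl_point (F : X -> X) (t : eucl R n) :
  (forall i : 'I_n, exists l : nat -> R, forall eps : R, 0 < eps -> exists2 d : R, 0 < d &
    forall v, l1norm n v <= d ->
      `|coord e i (F (eucl_point (eshift t v))) - coord e i (F (eucl_point t)) - dot_prod n l v|
        <= eps * l1norm n v) ->
  differentiable F (eucl_point t).
Proof.
move=> /choice[l Hl].
have [c c0 Hc] := coord_bounded be.
pose g (h : X) : X := \sum_(i < n) dot_prod n (l i) (coord_nat h) *: e`_i.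
have lin_g : linear g.
  move=> a u v; rewrite /g scaler_sumr -big_split/=; apply: eq_bigr => i _.
  rewrite scalerA -scalerDl; congr (_ *: _).
  rewrite /dot_prod mulr_sumr -big_split/=; apply: eq_bigr => j _.
  by rewrite !coord_natE linearP/=; ring.
pose G : {linear X -> X} := HB.pack g (GRing.isLinear.Build R X X _ g lin_g).
have [b b0 Hb] := linear_bounded G.
apply: (expansion_differentiable (bounded_linear_cont Hb)) => eps eps0.
pose M := \sum_(i < n) `|e`_i|.
have M0 : 0 <= M by exact: sumr_ge0.
pose N := n%:R * c.
have N0 : 0 <= N by rewrite mulr_ge0// ltW.
have lN h : l1norm n (coord_nat h) <= N * `|h|.
  apply: (@le_trans _ _ (\sum_(i < n) c * `|h|)).
    by apply: ler_sum => i _; rewrite coord_natE.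
  by rewrite sumr_const card_ord -mulr_natl /N mulrA.
(* [N] compares the l1 norm of the coordinates with the norm of [h], and [M] is the cost of
   recombining coordinate errors along the basis. *)
have e1 : 0 < eps / (M * N + 1) by rewrite divr_gt0// ltr_wpDl// mulr_ge0.
have /choice[d Hd] : forall i, exists d : R, 0 < d /\ forall v, l1norm n v <= d ->
      `|coord e i (F (eucl_point (eshift t v))) - coord e i (F (eucl_point t)) - dot_prod n (l i) v|
        <= eps / (M * N + 1) * l1norm n v.
  by move=> i; have [d d0 H] := Hl i _ e1; exists d.
(* The default 1 keeps [D] positive in dimension 0. *)
pose D := \big[Num.min/1]_(i < n) d i.
have D0 : 0 < D by rewrite /D; apply/bigmin_gtP; split => // i _; exact: (Hd i).1.
exists (D / (N + 1)); first by rewrite divr_gt0// ltr_wpDl.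
move=> h hD.
have vD : l1norm n (coord_nat h) <= D.
  apply: le_trans (lN h) _; apply: (@le_trans _ _ ((N + 1) * `|h|)).
    by rewrite ler_wpM2r//; lra.
  by rewrite mulrC -ler_pdivlMr// ltr_wpDl.
rewrite -eucl_point_shift.
have -> : F (eucl_point (eshift t (coord_nat h))) - F (eucl_point t) - G h =
  \sum_(i < n) (coord e i (F (eucl_point (eshift t (coord_nat h)))) - coord e i (F (eucl_point t))
     - dot_prod n (l i) (coord_nat h)) *: e`_i.
  rewrite {1}(coord_basis be (memvf (F (eucl_point (eshift t _))))).
  rewrite {1}(coord_basis be (memvf (F (eucl_point t)))).
  rewrite -!sumrB; apply: eq_bigr => i _.
  by rewrite !scalerBl.
apply: le_trans (ler_norm_sum _ _ _) _.
apply: (@le_trans _ _ (\sum_(i < n) eps / (M * N + 1) * (N * `|h|) * `|e`_i|)).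
  apply: ler_sum => i _; rewrite normrZ ler_wpM2r//.
  apply: le_trans ((Hd i).2 _ _) _.
    by apply: le_trans vD _; apply: bigmin_le_cond.
  by rewrite ler_wpM2l// ltW.
rewrite -mulr_sumr -/M (_ : _ * M = eps * `|h| * (M * N / (M * N + 1))); last by ring.
have MN : 0 <= M * N by rewrite mulr_ge0.
by rewrite ler_piMr ?mulr_ge0 ?(ltW eps0)// ler_pdivrMr//; lra.
Qed.

Lemma lipschitz_coord_eucl (F : X -> X) :
  (forall x y, `|F x - F y| <= `|x - y|) ->
  exists k, forall i, l1_lipschitz k (fun t => coord e i (F (eucl_point t))).
Proof.
move=> lF; have [c c0 Hc] := coord_bounded be.
pose M := \sum_(i < n) `|e`_i|.
exists (c * M) => i s t /=.
rewrite -linearB; apply: le_trans (Hc _ _) _; rewrite -mulrA ler_wpM2l ?(ltW c0)//.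
apply: le_trans (lF _ _) _; rewrite /eucl_point -sumrB.
apply: le_trans (ler_norm_sum _ _ _) _.
rewrite mulrC /l1norm mulr_suml; apply: ler_sum => j _.
rewrite -scalerBl normrZ ler_wpM2l// /M (bigD1 j)//= lerDl sumr_ge0//.
Qed.

End coordinates.

Lemma nonexpansive_differentiable_ae (R : realType) (X : finNormedModType R) (F : X -> X) :
  (forall x y, `|F x - F y| <= `|x - y|) -> ae_lebesgue (diff_points F).
Proof.
move=> lF e be; have [k lk] := lipschitz_coord_eucl be lF.
(* Rademacher's theorem is applied to each of the finitely many coordinate functions. *)
have ae1 : {ae euclidean_lebesgue R (\dim {:X}), forall t, forall i : 'I_(\dim {:X}),
    rat_diff setT (fun t => coord e i (F (eucl_point e t))) t}.
  apply: ae_forall_countable => i.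
  exists (~` rat_diff setT (fun t => coord e i (F (eucl_point e t)))); split => //.
    exact/measurableC/measurable_rat_diff/l1_lipschitz_measurable/lk.
  exact: rademacher_rat_diff (lk i).
apply: negligibleS ae1 => t /= nd H; apply: nd.
rewrite /diff_points/=; apply: (differentiable_eucl_point be) => i.
exact: rat_diff_expansion (lk i) (H i).
Qed.

Theorem theorem2p1 (R : realType) (X : finNormedModType R)
    (ip : {dot X for (idfun : R -> R)}) (ip_norm : norm_of_dot ip)
    (K : set X) (K_nonempty : K !=set0) (K_closed : closed K)
    (K_cone : convex_cone K) :
  ae_lebesgue (diff_points (metric_proj K)) /\
  (forall x : X, diff_points (metric_proj K) x ->
     psd ip (fderiv (metric_proj K) x)) /\
  (forall (x : X) (V : 'End(X)), clarke_jacobian (metric_proj K) x V ->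
     psd ip V) /\
  (* (i) *)
  (forall (x : X) (V : 'End(X)), clarke_jacobian (metric_proj K) x V ->
     opnorm V <= 1) /\
  (* (ii) *)
  (forall x : X, diff_points (metric_proj K) x ->
     fderiv (metric_proj K) x x = metric_proj K x) /\
  (* (iii) *)
  (forall (x : X) (V : 'End(X)), clarke_jacobian (metric_proj K) x V ->
     V x = metric_proj K x) /\
  (* (iv), on a nonzero space: operators on the zero space have no eigenvalue *)
  (forall (x : X) (V : 'End(X)), clarke_jacobian (metric_proj K) x V ->
     (0 < \dim {:X})%N ->
     exists lmin lmax : R,
       [/\ is_lambda_min V lmin, is_lambda_max V lmax, 0 <= lmin,
           lmin <= lmax & lmax <= 1]).
Proof.
have fspec := fderiv_proj_spec ip_norm K_nonempty K_closed K_cone.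
have cspec := clarke_jacobian_spec ip_norm K_nonempty K_closed K_cone.
split.
  exact: (nonexpansive_differentiable_ae (proj_nonexpansive ip_norm K_nonempty K_closed K_cone)).
split; first by move=> x /fspec[].
split; first by move=> x V /cspec[].
split.
  by move=> x V /cspec[_ _ nV _]; apply: opnorm_le => // y; rewrite mul1r.
split; first by move=> x /fspec[].
split; first by move=> x V /cspec[].
move=> x V /cspec[sa ps nV _] d0.
have [lmin [emin Hmin]] := rayleigh_min ip_norm sa d0.
have [lmax [emax Hmax]] := rayleigh_max ip_norm sa d0.
exists lmin, lmax; split => //; last 1 first.
- have /leigenvalueP[v v0 Vv] := emax.
  have v1 : 0 < `|v| by rewrite normr_gt0.
  apply: le_trans (ler_norm _) _; rewrite -(ler_pM2r v1) mul1r -normrZ -Vv.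
  exact: nV.
- have /leigenvalueP[v v0 Vv] := emin.
  have := ps v; rewrite Vv ipZl (ip_sqr ip_norm) pmulr_lge0//.
  by rewrite exprn_gt0// normr_gt0.
- exact: Hmin.
Qed.
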